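(* As $n\to\infty$, $$g(n,K_3,P_6)=(1+o(1))\frac{n}{2},$$ where $P_6$ is the path on $6$ vertices.
   Context: Constructor-Blocker game: given graphs $H$ and $F$, two players, Constructor and Blocker, alternately claim previously unclaimed edges of the complete graph $K_n$, Constructor moving first. Constructor may only claim an edge if her graph (the edges she has claimed) remains $F$-free (contains no subgraph isomorphic to $F$); Blocker may claim any unclaimed edge. The game ends when Constructor cannot claim any more edges or all edges are claimed. The score is the number of copies of $H$ in Constructor's graph at the end. Constructor maximizes, Blocker minimizes; $g(n,H,F)$ denotes the score under optimal play by both. *)

(* Defs.v *)
From mathcomp Require Import all_boot all_order all_algebra.
Set Implicit Arguments. Unset Strict Implicit. Unset Printing Implicit Defensive.

Definition graph (n : nat) := {set {set 'I_n}}.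

Definition is_edge n (e : {set 'I_n}) : bool := #|e| == 2.

Definition has_path (k n : nat) (G : graph n) : bool :=
  [exists f : {ffun 'I_k.+1 -> 'I_n},
     injectiveb f &&
     [forall i : 'I_k,
        [set f (widen_ord (leqnSn k) i); f (lift ord0 i)] \in G]].

Definition P6_free n (G : graph n) : bool := ~~ has_path 5 G.

Definition triangles n (G : graph n) : nat :=
  #|[set T : {set 'I_n} | (#|T| == 3) &&
      [forall x in T, forall y in T, (x != y) ==> ([set x; y] \in G)]]|.

Definition unclaimed n (C B : graph n) : {set {set 'I_n}} :=
  [set e : {set 'I_n} | [&& is_edge e, e \notin C & e \notin B]].

Definition cmoves n (C B : graph n) : {set {set 'I_n}} :=
  [set e in unclaimed C B | P6_free (e |: C)].

(* Game value (Constructor maximizes, Blocker minimizes, score = triangles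
   in Constructor's final graph).  [fuel] bounds the number of remaining moves;
   the game ends when Constructor has no legal move (on her turn) or all
   edges are claimed.  [cturn] = true means it is Constructor's turn. *)
Fixpoint gval n (fuel : nat) (cturn : bool) (C B : graph n) : nat :=
  match fuel with
  | 0 => triangles C
  | k.+1 =>
    if cturn then
      match [pick e in cmoves C B] with
      | None => triangles C
      | Some e0 => \big[maxn/gval k false (e0 |: C) B]_(e in cmoves C B)
                      gval k false (e |: C) B
      end
    else
      match [pick e in unclaimed C B] with
      | None => triangles C
      | Some e0 => \big[minn/gval k true C (e0 |: B)]_(e in unclaimed C B)
                      gval k true C (e |: B)
      end
  end.

(* g(n, K_3, P_6): start with nothing claimed, Constructor to move; the fuel
   #|edges of K_n| suffices since every move claims a fresh edge. *)
Definition g_K3_P6 (n : nat) : nat :=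
  gval #|[set e : {set 'I_n} | is_edge e]| true (set0 : graph n) set0.

(* Main.v *)
Require Import Defs.
From mathcomp Require Import all_boot all_order all_algebra zify ring lra.
From Stdlib Require Import Classical.
Set Implicit Arguments. Unset Strict Implicit. Unset Printing Implicit Defensive.

(** Upper bound.  Blocker always answers inside the component of the edge just
    claimed.  Since ['C(k, 2)] and [k./2] have the same parity, this alone keeps
    (Constructor's edges) - (Blocker's edges) at most [k./2] in each component
    with [k <= 5] vertices, so that five vertices carry at most six edges of
    Constructor, which excludes the fan [K_1 + P_4].  In a P6-free graph without
    [K_4] and without fans, the triangles of a component either pairwise share
    just one common vertex, and then [2 t <= k - 1], or share an edge [uv]; if
    there are more than two of them, all edges of the component meet [uv].
    In such a book Blocker keeps [t <= b + 2], where [b] counts the vertices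
    joined by Constructor to exactly one of [u], [v] and by Blocker to the
    other, and this gives [2 t <= k].  A move of Constructor endangers at most one of these
    conditions, and a single reply restores it.

    Lower bound.  Constructor repeatedly picks an unused vertex [u] with few of
    Blocker's edges among the unused vertices and grows a star at [u] until no
    edge is left, then a star at a leaf [v] inside the leaves of [u], where [v]
    again sees few of Blocker's edges.  If [u] has [l] leaves she gets about
    [l / 2] triangles from [l + 1] vertices, and every component is covered by
    the two hubs, which a path on six vertices cannot be. *)

(** * Graphs as sets of edges *)

Definition adj n (X : graph n) (x y : 'I_n) : bool := [set x; y] \in X.
Definition simple n (X : graph n) := forall e, e \in X -> is_edge e.

Section Graphs.
Context {n : nat}.
Implicit Types (X C B : graph n) (x y z : 'I_n) (K : {set 'I_n}).

Lemma adjC X x y : adj X x y = adj X y x.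
Proof. by rewrite /adj setUC. Qed.

Lemma adj_neq X x y : simple X -> adj X x y -> x != y.
Proof. by move=> sX /sX; rewrite /is_edge cards2; case: (x == y). Qed.

Lemma eq_set2 x y z t :
  ([set x; y] == [set z; t]) = (x == z) && (y == t) || (x == t) && (y == z).
Proof.
apply/eqP/orP => [E|[|]/andP[/eqP-> /eqP->]] //; last by rewrite setUC.
have : x \in [set z; t] by rewrite -E set21.
have : y \in [set z; t] by rewrite -E set22.
have : z \in [set x; y] by rewrite E set21.
have : t \in [set x; y] by rewrite E set22.
rewrite !inE (eq_sym z x) (eq_sym z y) (eq_sym t x) (eq_sym t y).
by case: (x == z); case: (y == t); case: (x == t); case: (y == z); auto.
Qed.

Lemma set2_injr (u s w : 'I_n) : [set u; s] = [set u; w] -> s = w.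
Proof.
by move/eqP; rewrite eq_set2 => /orP[]/andP[/eqP h1 /eqP h2]; rewrite h2.
Qed.

Lemma is_edgeP (e : {set 'I_n}) : is_edge e -> exists x y, x != y /\ e = [set x; y].
Proof. by move=> /cards2P[x [y [xy ->]]]; exists x, y. Qed.

Lemma is_edge2 x y : is_edge [set x; y] = (x != y).
Proof. by rewrite /is_edge cards2; case: (x != y). Qed.

Lemma no_P6 X a b c d e f : P6_free X -> uniq [:: a; b; c; d; e; f] ->
  adj X a b -> adj X b c -> adj X c d -> adj X d e -> adj X e f -> False.
Proof.
move=> /negP F U ab bc cd de ef; apply: F; apply/existsP.
exists [ffun i : 'I_6 => nth a [:: a; b; c; d; e; f] i]; apply/andP; split.
  apply/injectiveP => i j; rewrite !ffunE => /eqP.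
  by rewrite nth_uniq //; move=> /eqP/val_inj.
apply/forallP => i; rewrite !ffunE /=.
by case: i; do 5?[case=> [|] //].
Qed.

Lemma P6_freeI X :
  (forall a b c d e f, uniq [:: a; b; c; d; e; f] -> adj X a b -> adj X b c ->
     adj X c d -> adj X d e -> adj X e f -> False) -> P6_free X.
Proof.
move=> H; apply/negP => /existsP[f /andP[/injectiveP finj /forallP fadj]].
pose o (i : nat) : 'I_6 := inord i.
apply: (H (f (o 0)) (f (o 1)) (f (o 2)) (f (o 3)) (f (o 4)) (f (o 5))).
- rewrite -[X in uniq X]/(map f (map o (iota 0 6))) map_inj_uniq //.
  rewrite map_inj_in_uniq ?iota_uniq // => i j; rewrite !mem_iota /= => hi hj.
  by move=> /(congr1 val); rewrite /= !inordK.
all: move: (fadj (inord 0)) (fadj (inord 1)) (fadj (inord 2)) (fadj (inord 3))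
  (fadj (inord 4)); rewrite /adj => h0 h1 h2 h3 h4.
- move: h0; congr ([set f _; f _] \in X); apply: val_inj; rewrite /= ?inordK //.
- move: h1; congr ([set f _; f _] \in X); apply: val_inj; rewrite /= ?inordK //.
- move: h2; congr ([set f _; f _] \in X); apply: val_inj; rewrite /= ?inordK //.
- move: h3; congr ([set f _; f _] \in X); apply: val_inj; rewrite /= ?inordK //.
- move: h4; congr ([set f _; f _] \in X); apply: val_inj; rewrite /= ?inordK //.
Qed.

End Graphs.

(** * The conditions maintained by Blocker *)

Ltac ad := match goal with
  | H : is_true (adj ?X ?x ?y) |- is_true (adj ?X ?x ?y) => exact H
  | H : is_true (adj ?X ?y ?x) |- is_true (adj ?X ?x ?y) => rewrite adjC; exact H
  end.
Ltac ne := match goal with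
  | H : is_true (~~ (@eq_op _ ?x ?y)) |- is_true (~~ (@eq_op _ ?x ?y)) => exact H
  | H : is_true (~~ (@eq_op _ ?y ?x)) |- is_true (~~ (@eq_op _ ?x ?y)) =>
      rewrite eq_sym; exact H
  | S : simple ?X, H : is_true (adj ?X ?x ?y) |- is_true (~~ (@eq_op _ ?x ?y)) =>
      exact (adj_neq S H)
  | S : simple ?X, H : is_true (adj ?X ?y ?x) |- is_true (~~ (@eq_op _ ?x ?y)) =>
      rewrite eq_sym; exact (adj_neq S H)
  end.
Ltac distinct := rewrite /= ?inE ?negb_or; repeat (apply/andP; split); try done; ne.
(** Refutes the current configuration through the six-vertex path [a b c d e f]. *)
Ltac p6 F a b c d e f :=
  exfalso; apply: (@no_P6 _ _ a b c d e f F); [distinct | ad ..].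

Ltac distinct_edges :=
  rewrite /= ?inE ?negb_or ?eq_set2 ?eqxx;
  repeat match goal with H : is_true (?x != ?y) |- _ =>
    rewrite ?(negPf H) ?(eq_sym y x) ?(negPf H); clear H end;
  by rewrite ?andbF ?andbT ?orbF.

(* The bound improves by one because ['C(k, 2)] and [k./2] have the same parity. *)
Lemma parity_bound k c b : k <= 5 -> c + b = 'C(k, 2) ->
  c <= (b + k./2).+1 -> c <= b + k./2.
Proof. by case: k => [|[|[|[|[|[|]]]]]] // _; rewrite ?binE /=; move=> *; lia. Qed.

Section Conditions.
Context {n : nat}.
Implicit Types (X Y C B : graph n) (x y z : 'I_n) (K : {set 'I_n}).

(** Such sets are the unions of components of [X]; statements about a component are phrased for all
    of them. *)
Definition adj_closed X K := forall x y, x \in K -> adj X x y -> y \in K.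
Definition inner X K : graph n := [set e in X | e \subset K].

(* For an edge [u v] this says that every edge of its component meets [u v]. *)
Definition covering X u v := forall s t, adj X u s || adj X v s -> adj X s t ->
  [|| s == u, s == v, t == u | t == v].
Definition pages X u v := [set x | adj X u x && adj X v x].
Definition blocked X B u v :=
  [set x | adj X u x && adj B v x || adj X v x && adj B u x].
(** These are the vertices that a single further edge of Blocker moves into [blocked], and that a
    single edge of Constructor turns into a page. *)
Definition open_half X B u v x := [&& x != u, x != v &
  [&& adj X u x, ~~ adj X v x & ~~ adj B v x] ||
  [&& adj X v x, ~~ adj X u x & ~~ adj B u x]].

Definition count_cond X B := forall K, adj_closed X K -> #|K| <= 5 ->
  #|inner X K| <= #|inner B K| + #|K|./2.
(** Otherwise Constructor could claim [u v] and obtain at once a covering edge with two pages. *)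
Definition pair_cond X B := forall u v x y, u != v -> x != y -> ~~ adj X u v ->
  adj X u x -> adj X v x -> adj X u y -> adj X v y -> covering X u v -> adj B u v.
(** A blocked vertex hangs on one end of the spine without being a page. It lengthens paths through
    the book, and it keeps the bound of [book_cond] above two. *)
Definition spine_cond X B := forall u v w, adj X u v -> w != v -> adj X u w ->
  covering X u v -> exists x, x \in blocked X B u v.
(** The last unit of slack may be used up only when no vertex can become a page in one move. *)
Definition book_cond X B := forall u v, adj X u v -> covering X u v ->
  #|pages X u v| <= #|blocked X B u v|.+1 \/
  #|pages X u v| <= #|blocked X B u v|.+2 /\ forall x, ~~ open_half X B u v x.
(** The edge [x y] would complete a [K_4]. Blocker must own it unless there is a third page: then,
    by [spine_cond], it would also complete a path on six vertices. *)
Definition diamond_cond X B := forall u v x y, x != y -> adj X u v ->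
  adj X u x -> adj X v x -> adj X u y -> adj X v y ->
  ~~ adj X x y /\
  (adj B x y \/ exists z, [&& z != x, z != y, adj X u z & adj X v z]).

Lemma coveringC X u v : covering X u v -> covering X v u.
Proof.
move=> H s t h /H; rewrite orbC in h => /(_ h).
by do 4!case: (_ == _).
Qed.

Lemma covering_set2 X (p q u v : 'I_n) : [set p; q] = [set u; v] -> covering X p q -> covering X u v.
Proof.
by move/eqP; rewrite eq_set2 => /orP[]/andP[/eqP-> /eqP->] // /coveringC.
Qed.

Lemma blockedC X B u v : blocked X B u v = blocked X B v u.
Proof. by apply/setP => x; rewrite !inE orbC. Qed.

Lemma pagesC X u v : pages X u v = pages X v u.
Proof. by apply/setP => x; rewrite !inE andbC. Qed.

Lemma open_halfC X B u v x : open_half X B u v x = open_half X B v u x.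
Proof. by rewrite /open_half orbC andbCA. Qed.

Lemma adj_sub X Y x y : X \subset Y -> adj X x y -> adj Y x y.
Proof. by move=> /subsetP; apply. Qed.

Lemma blockedS X B B' u v : B \subset B' -> blocked X B u v \subset blocked X B' u v.
Proof.
move=> sB; apply/subsetP => x; rewrite !inE.
by case/orP=> /andP[-> /(adj_sub sB)->]; rewrite ?orbT.
Qed.

Lemma open_halfS X B B' u v x : B \subset B' ->
  open_half X B' u v x -> open_half X B u v x.
Proof.
move=> sB /and3P[xu xv H]; rewrite /open_half xu xv /=.
case/orP: H => /and3P[-> -> h] /=; rewrite (contra _ h) ?orbT //; exact: adj_sub.
Qed.

Lemma innerS X Y K : X \subset Y -> inner X K \subset inner Y K.
Proof. by move=> sXY; apply/subsetP => e; rewrite !inE => /andP[/(subsetP sXY)-> ->]. Qed.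

Lemma inner_ge X K (l : seq {set 'I_n}) : uniq l ->
  all (fun g => (g \in X) && (g \subset K)) l -> size l <= #|inner X K|.
Proof.
move=> U /allP H; rewrite -(card_uniqP U); apply/subset_leq_card/subsetP => g /H.
by rewrite inE.
Qed.

(** * Further edges of Blocker preserve every condition *)

Section Monotone.
Variables (X B B' : graph n).
Hypothesis sB : B \subset B'.

Lemma count_condS : count_cond X B -> count_cond X B'.
Proof.
move=> H K cK K5; apply: leq_trans (H K cK K5) _.
by rewrite leq_add2r subset_leq_card // innerS.
Qed.

Lemma pair_condS : pair_cond X B -> pair_cond X B'.
Proof. move=> H u v x y *; apply: adj_sub sB _; exact: (H u v x y). Qed.

Lemma spine_condS : spine_cond X B -> spine_cond X B'.
Proof.
by move=> H u v w uv wv uw c; have [x /(subsetP (blockedS X u v sB))] := H u v w uv wv uw c; exists x.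
Qed.

Lemma book_condS : book_cond X B -> book_cond X B'.
Proof.
move=> H u v uv c; have le := subset_leq_card (blockedS X u v sB).
case: (H u v uv c) => [h|[h1 h2]]; [left; lia|right; split; first lia].
by move=> x; apply: contra (h2 x); apply: open_halfS.
Qed.

Lemma diamond_condS : diamond_cond X B -> diamond_cond X B'.
Proof.
move=> H u v x y xy uv ux vx uy vy; have [h1 h2] := H u v x y xy uv ux vx uy vy.
by split=> //; case: h2 => [/(adj_sub sB)|]; [left|right].
Qed.
End Monotone.

Lemma card_inner_simple X K : simple X -> #|K| = 5 -> #|inner X K| <= 10.
Proof.
move=> sX K5; have <- : 'C(#|K|, 2) = 10 by rewrite K5.
rewrite -(cards_draws K 2); apply: subset_leq_card; apply/subsetP => e.
by rewrite !inE => /andP[/sX e2 ->].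
Qed.

(* A 5-cycle in a P6-free graph spans a whole component. *)
Lemma fan_closed X w z a b c : P6_free X -> simple X ->
  z != b -> z != c -> a != c ->
  adj X w z -> adj X w a -> adj X w b -> adj X w c ->
  adj X z a -> adj X a b -> adj X b c ->
  exists K, [/\ adj_closed X K, #|K| = 5 & 6 < #|inner X K|].
Proof.
move=> F sX zb zc ac wz wa wb wc za ab bc; pose K := [set w; z; a; b; c].
have U : uniq [:: w; z; a; b; c] by distinct.
have KE : K =i [:: w; z; a; b; c] by move=> x; rewrite !inE -!orbA.
exists K; split.
- move=> s t sK st; apply: contraT; rewrite KE !inE !negb_or => /and5P[tw tz ta tb tc].
  move: sK; rewrite KE !inE => /orP[|/orP[|/orP[|/orP[|]]]] /eqP ?; subst s.
  + p6 F t w z a b c.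
  + p6 F t z a b c w.
  + p6 F t a b c w z.
  + p6 F t b c w z a.
  + p6 F t c w z a b.
- by rewrite (eq_card KE) (card_uniqP U).
- pose l := [:: [set w; z]; [set w; a]; [set w; b]; [set w; c]; [set z; a]; [set a; b]; [set b; c]].
  move: (U); rewrite /= !inE !negb_or -!andbA; repeat (case/andP => ?); move=> _.
  have Ul : uniq l by distinct_edges.
  apply: (inner_ge Ul); apply/allP => e.
  by rewrite !inE; do 6?[case/orP]; move/eqP->; apply/andP; split; rewrite // subUset !sub1set !inE !eqxx ?orbT.
Qed.

End Conditions.

(** * Blocker's reply *)

Section Pages.
Context {n : nat}.
Implicit Types (X C B : graph n) (x y z : 'I_n) (K : {set 'I_n}).

Definition no_K4 X := forall u v x y, adj X u v -> adj X u x -> adj X v x ->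
  adj X u y -> adj X v y -> adj X x y -> False.

Lemma page_avoid X u v a b : 2 < #|pages X u v| ->
  exists x, [/\ adj X u x, adj X v x, x != a & x != b].
Proof.
move=> H; have [x xP xab] : exists2 x, x \in pages X u v & x \notin [set a; b].
  by apply/subsetPn; apply/negP => /subset_leq_card; rewrite cards2; case: (a != b) H => /=; lia.
move: xP xab; rewrite !inE negb_or => /andP[ux vx] /andP[xa xb].
by exists x.
Qed.

Lemma three_pages X u v x y z : x != y -> z != x -> z != y ->
  adj X u x -> adj X v x -> adj X u y -> adj X v y -> adj X u z -> adj X v z ->
  2 < #|pages X u v|.
Proof.
move=> xy zx zy ux vx uy vy uz vz.
have U : uniq [:: x; y; z] by distinct.
rewrite -[3]/(size [:: x; y; z]) -(card_uniqP U); apply: subset_leq_card.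
by apply/subsetP => t; rewrite !inE => /or3P[] /eqP->; apply/andP.
Qed.

Lemma no_K4_diamond X B : simple X -> diamond_cond X B -> no_K4 X.
Proof.
move=> sX H u v x y uv ux vx uy vy xy.
have [|/negP] // := H u v x y _ uv ux vx uy vy; exact: adj_neq xy.
Qed.

(** Let an edge [s t] miss [u] and [v], with [s] next to [u]. Either [u, v, s, t] span a [K_4], or
    the edge continues through [u], a page, [v] and a second page to a path on six vertices. *)
Lemma covering_pages X u v : P6_free X -> simple X -> no_K4 X -> adj X u v ->
  2 < #|pages X u v| -> covering X u v.
Proof.
move=> F sX K4 uv P; wlog suff H : u v uv P /
    forall s t, adj X u s -> adj X s t -> [|| s == u, s == v, t == u | t == v].
  move=> s t /orP[us st|vs st]; first exact: H.
  have := H v u _ _ s t vs st; rewrite adjC pagesC => /(_ uv P).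
  by case/or4P=> ->; rewrite ?orbT.
move=> s t us st; apply: contraT; rewrite !negb_or => /and4P[su sv tu tv].
have [vs|vs] := boolP (adj X v s); have [/andP[ut vt]|tP] := boolP (adj X u t && adj X v t).
- by case: (K4 u v s t).
- have [y [uy vy ys yt]] := page_avoid s t P.
  have [y' [uy' vy' ys' yy']] := page_avoid s y P.
  have yt' : y' != t by apply: contraNneq tP => <-; rewrite uy' vy'.
  p6 F t s u y v y'.
- have [y [uy vy yt ys]] := page_avoid t s P.
  have [y' [uy' vy' yt' yy']] := page_avoid t y P.
  have ys' : y' != s by apply: contraNneq vs => <-.
  p6 F s t u y v y'.
- have [y [uy vy yt ys]] := page_avoid t s P.
  have [y' [uy' vy' yt' yy']] := page_avoid t y P.
  have ys' : y' != s by apply: contraNneq vs => <-.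
  p6 F t s u y v y'.
Qed.
End Pages.

(** * One move [e] of Constructor from a position satisfying all conditions *)

Section Step.
Context {n : nat} (C B : graph n) (e : {set 'I_n}).
Hypotheses (sC : simple C) (sB : simple B).
Hypothesis dCB : forall f, f \in C -> f \notin B.
Hypothesis Cc : count_cond C B.
Hypothesis Nc : pair_cond C B.
Hypothesis Dc : spine_cond C B.
Hypothesis Bc : book_cond C B.
Hypothesis Qc : diamond_cond C B.
Hypotheses (e2 : is_edge e) (eC : e \notin C) (eB : e \notin B).
Notation C' := (e |: C).
Hypothesis F' : P6_free C'.

Let old x y : adj C x y -> adj C' x y.
Proof. by apply: adj_sub; exact: subsetUr. Qed.

Let sC' : simple C'.
Proof. by move=> f; rewrite in_setU1 => /orP[/eqP->|/sC]. Qed.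

Let adj'P x y : adj C' x y -> [set x; y] = e \/ adj C x y.
Proof. by rewrite /adj in_setU1 => /orP[/eqP|]; [left|right]. Qed.

Let F : P6_free C.
Proof.
apply: P6_freeI => a b c d f g U ab bc cd df fg.
by apply: (no_P6 F' U); apply: old.
Qed.

Let disj x y : adj C x y -> adj B x y -> False.
Proof. by move=> /dCB /negP. Qed.

Let disj' x y : adj C' x y -> adj B x y -> False.
Proof. by move=> /adj'P[E|/disj //]; rewrite /adj E; apply/negP. Qed.

Let newE x y : [set x; y] = e -> adj C' x y.
Proof. by move=> E; rewrite /adj E setU11. Qed.

Let new_not_old x y : [set x; y] = e -> ~~ adj C x y.
Proof. by rewrite /adj => ->. Qed.

Let old1 p q r s : [set p; q] = e -> r != p -> r != q -> adj C' r s -> adj C r s.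
Proof.
move=> E rp rq /adj'P[E2|//]; have := set21 r s.
by rewrite E2 -E !inE (negPf rp) (negPf rq).
Qed.

Lemma covering_old u v : covering C' u v -> covering C u v.
Proof.
move=> H s t h st; apply: H (old st).
by case/orP: h => /old ->; rewrite ?orbT.
Qed.

Lemma closed_old K : adj_closed C' K -> adj_closed C K.
Proof. by move=> H x y xK /old; apply: H. Qed.

Lemma inner_new_le K : #|inner C' K| <= #|inner C K|.+1.
Proof.
have : inner C' K \subset e |: inner C K.
  by apply/subsetP => f; rewrite !inE => /andP[/orP[->|->] ->]; rewrite ?orbT.
move=> /subset_leq_card; rewrite cardsU1; case: (_ \notin _) => /=; lia.
Qed.

Lemma inner_disjoint K : #|inner C' K| + #|inner B K| = #|inner (C' :|: B) K|.
Proof.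
rewrite -cardsUI; have -> : inner C' K :&: inner B K = set0.
  apply/setP => f; rewrite !inE; apply/negP => /andP[/andP[/orP[/eqP->|fC] _] /andP[fB _]].
    exact: (negP eB).
  by move: (dCB fC); rewrite fB.
by rewrite cards0 addn0; congr #|pred_of_set _|; apply/setP => f; rewrite !inE -andb_orl.
Qed.

(** Before the move [c <= b + 2], after it [c <= b + 3]; together with [c + b <= 10] this leaves
    [c <= 6]. *)
Lemma card5_inner K : adj_closed C' K -> #|K| = 5 -> #|inner C' K| <= 6.
Proof.
move=> cK K5; have h1 := Cc (closed_old cK).
have h2 := inner_new_le K; have h3 := inner_disjoint K.
have : #|inner (C' :|: B) K| <= 10.
  by apply: card_inner_simple => // f; rewrite inE => /orP[/sC'|/sB].
move: h1; rewrite K5 => /(_ isT) h1 h4; lia.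
Qed.

Lemma no_fan' w z a b c : z != b -> z != c -> a != c ->
  adj C' w z -> adj C' w a -> adj C' w b -> adj C' w c ->
  adj C' z a -> adj C' a b -> adj C' b c -> False.
Proof.
move=> zb zc ac wz wa wb wc za ab bc.
have [K [cK K5 h]] := fan_closed F' sC' zb zc ac wz wa wb wc za ab bc.
by move: (leq_trans h (card5_inner cK K5)).
Qed.

Let K4C : no_K4 C := no_K4_diamond sC Qc.

(** Blocker does not hold [x y], so there is a third page [z]. Then [u v] is covering, [spine_cond]
    gives a blocked vertex [s] at one end of the spine, and [s u x y v z] or its mirror image is a
    path on six vertices. *)
Let no_K4'_new u v x y : [set x; y] = e -> adj C u v -> adj C u x -> adj C v x ->
  adj C u y -> adj C v y -> False.
Proof.
move=> E uv ux vx uy vy.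
have xy : x != y by rewrite -is_edge2 E.
have xy' := newE E.
have [_ [bxy|[z /and4P[zx zy uz vz]]]] := Qc xy uv ux vx uy vy.
  exact: disj' xy' bxy.
have P := three_pages xy zx zy ux vx uy vy uz vz.
have cov := covering_pages F sC K4C uv P.
have xv : x != v by rewrite eq_sym; ne.
have [s] := Dc uv xv ux cov.
rewrite inE => /orP[] /andP[h b].
- have [sx sy sz] : [/\ s != x, s != y & s != z].
    by split; apply/eqP => ?; subst s; apply: disj b.
  have sv := adj_neq sB b.
  move: (old uv) (old ux) (old vx) (old uy) (old vy) (old uz) (old vz) (old h) => *.
  p6 F' s u x y v z.
- have [sx sy sz] : [/\ s != x, s != y & s != z].
    by split; apply/eqP => ?; subst s; apply: disj b.
  have sv := adj_neq sB b.
  move: (old uv) (old ux) (old vx) (old uy) (old vy) (old uz) (old vz) (old h) => *.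
  p6 F' s v x y u z.
Qed.

Lemma no_K4' : no_K4 C'.
Proof.
move=> u v x y uv ux vx uy vy xy.
have nuv := adj_neq sC' uv; have nux := adj_neq sC' ux; have nvx := adj_neq sC' vx.
have nuy := adj_neq sC' uy; have nvy := adj_neq sC' vy; have nxy := adj_neq sC' xy.
(* Each of the six edges may be the new one; the five others then have an endpoint outside it and
   are old. *)
have aux p q r s : p != q -> p != r -> p != s -> q != r -> q != s ->
    adj C' p q -> adj C' p r -> adj C' q r -> adj C' p s -> adj C' q s ->
    [set r; s] = e -> False.
  move=> pq pr ps qr qs h1 h2 h3 h4 h5 E.
  by apply: (no_K4'_new (u := p) (v := q) E); apply: old1 E _ _ _.
case: (adj'P xy) => [E|oxy]; first by apply: (aux u v x y).
case: (adj'P uv) => [E|ouv]; first by apply: (aux x y u v) => //; ad || ne.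
case: (adj'P ux) => [E|oux]; first by apply: (aux v y u x) => //; ad || ne.
case: (adj'P vx) => [E|ovx]; first by apply: (aux u y v x) => //; ad || ne.
case: (adj'P uy) => [E|ouy]; first by apply: (aux v x u y) => //; ad || ne.
case: (adj'P vy) => [E|ovy]; first by apply: (aux u x v y) => //; ad || ne.
exact: (K4C ouv oux ovx ouy ovy oxy).
Qed.

(** A violation must use the new edge, say as [s c]. Covering forces the edge from [c] to the third
    vertex [w] of the triangle to meet [s] or [t]; but [w] differs from [s], and [w = t] would make
    [s] and [t] adjacent. *)
Lemma pair_cond_triangle p q w : [set p; q] = e -> adj C' w p -> adj C' w q ->
  pair_cond C' B.
Proof.
move=> E wp wq s t c d st cd nst sc tc sd td cov.
have aux s' t' c' : s' != t' -> ~~ adj C' s' t' -> adj C' s' c' -> adj C' t' c' ->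
    covering C' s' t' -> [set s'; c'] = e -> False.
  move=> st' nst' sc' tc' cov' E'.
  have [ws wc] : adj C' w s' /\ adj C' w c'.
    have : [set s'; c'] == [set p; q] by rewrite E E'.
    rewrite eq_set2.
    by case/orP=> /andP[/eqP-> /eqP->]; split.
  have := cov' c' w; rewrite sc' (adjC _ c' w) wc => /(_ isT isT).
  case/or4P=> /eqP ?; subst.
  - by have := adj_neq sC' sc'; rewrite eqxx.
  - by have := adj_neq sC' tc'; rewrite eqxx.
  - by have := adj_neq sC' ws; rewrite eqxx.
  - by move: nst'; rewrite adjC ws.
have st' : t != s by rewrite eq_sym.
have nts : ~~ adj C' t s by rewrite adjC.
have cov' := coveringC cov.
case: (adj'P sc) => [h|osc]; first by case: (aux s t c).
case: (adj'P tc) => [h|otc]; first by case: (aux t s c).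
case: (adj'P sd) => [h|osd]; first by case: (aux s t d).
case: (adj'P td) => [h|otd]; first by case: (aux t s d).
apply: (Nc st cd) => //; last exact: covering_old.
by apply: contra nst; apply: old.
Qed.

(** The four edges to [x] and [y] were there before the move, so [pair_cond] had already given [p q]
    to Blocker. *)
Lemma new_covering_pages p q x y : [set p; q] = e -> covering C' p q -> x != y ->
  adj C' p x -> adj C' q x -> adj C' p y -> adj C' q y -> False.
Proof.
move=> E cov xy px qx py qy.
have pq : p != q by rewrite -is_edge2 E.
apply: (disj' (newE E)); apply: (Nc pq xy) (covering_old cov); first exact: new_not_old.
- by rewrite adjC; apply: (old1 E); rewrite 1?adjC //; ne.
- by rewrite adjC; apply: (old1 E); rewrite 1?adjC //; ne.
- by rewrite adjC; apply: (old1 E); rewrite 1?adjC //; ne.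
- by rewrite adjC; apply: (old1 E); rewrite 1?adjC //; ne.
Qed.

Let selfF (X : graph n) x : simple X -> adj X x x -> False.
Proof. by move=> sX /(adj_neq sX); rewrite eqxx. Qed.

(* If an old edge violates the condition, it was isolated before [e] was
   attached to it, and then [e] violates the condition as well. *)
Lemma spine_violation B2 : simple B2 -> spine_cond C B2 -> ~ spine_cond C' B2 ->
  exists p q w, [/\ [set p; q] = e, covering C' p q,
    forall x, x \notin blocked C' B2 p q, w != q & adj C' p w].
Proof.
move=> sB2 D2 nD; apply: NNPP => H; apply: nD => u v w uv wv uw cov.
apply: NNPP => nb; apply: H.
have nbl x : x \notin blocked C' B2 u v by apply/negP => h; apply: nb; exists x.
have [E|ouv] := adj'P uv; first by exists u, v, w.
have blS : blocked C B2 u v \subset blocked C' B2 u v.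
  apply/subsetP => x; rewrite !inE.
  by case/orP=> /andP[/old-> ->]; rewrite ?orbT.
have Hu w' : adj C u w' -> w' = v.
  move=> uw'; have [//|wv'] := eqVneq w' v.
  have [x /(subsetP blS) h] := D2 u v w' ouv wv' uw' (covering_old cov).
  by case: nb; exists x.
have Hv w' : adj C v w' -> w' = u.
  move=> vw'; have [//|wu'] := eqVneq w' u.
  have vu : adj C v u by ad.
  have [x] := D2 v u w' vu wu' vw' (coveringC (covering_old cov)).
  by rewrite blockedC => /(subsetP blS) h; case: nb; exists x.
have E : [set u; w] = e.
  by have [//|/Hu wv2] := adj'P uw; rewrite wv2 eqxx in wv.
have nuw := adj_neq sC' uw; have nuv := adj_neq sC' uv.
have nwv : adj C' w v -> False.
  rewrite adjC => vw; have := old1 E (r := v) (s := w).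
  by rewrite (eq_sym v u) nuv (eq_sym v w) => /(_ isT wv vw) /Hv wu; rewrite wu eqxx in nuw.
exists u, w, v; split=> //.
- move=> s t /orP[us|ws] st.
    have [E2|/Hu sv] := adj'P us.
      by rewrite (set2_injr (etrans E2 (esym E))) eqxx !orbT.
    subst s; have [E2|/Hv tu] := adj'P st; last by rewrite tu eqxx !orbT.
    move/eqP: (etrans E2 (esym E)); rewrite eq_set2 => /orP[]/andP[h _].
      by rewrite eq_sym (negPf nuv) in h.
    by rewrite eq_sym (negPf wv) in h.
  have := cov w s; rewrite uw => /(_ isT ws).
  case/or4P=> h; rewrite ?h ?orbT //.
  + by rewrite eq_sym (negPf nuw) in h.
  + by rewrite (negPf wv) in h.
  + by move/eqP: h => h; subst s; case: nwv.
- move=> x; apply/negP; rewrite inE => /orP[]/andP[h b].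
    have [E2|/Hu xv] := adj'P h.
      by rewrite (set2_injr (etrans E2 (esym E))) in b; apply: selfF b.
    subst x; move: (nbl w); rewrite inE uw adjC.
    by move: b; rewrite /adj setUC => ->.
  have := cov w x; rewrite uw => /(_ isT h).
  case/or4P=> /eqP hh; subst.
  + exact: selfF uw.
  + by rewrite eqxx in wv.
  + exact: selfF b.
  + exact: nwv.
- by rewrite eq_sym.
Qed.

(** Only the other end [y] of [e] can become a page. If it does, it was an open half, so the first
    alternative of [book_cond] held before the move. Either way the pages exceed the blocked
    vertices by at most two, and the violation lies in an open half that remains. *)
Let book_violation_at p q : adj C p q -> covering C' p q -> p \in e ->
  #|blocked C' B p q|.+1 < #|pages C' p q| ->
  (#|pages C' p q| <= #|blocked C' B p q|.+2 -> exists z, open_half C' B p q z) ->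
  exists y, [/\ [set p; y] = e, y != q, 2 < #|pages C' p q|,
    #|pages C' p q| <= #|blocked C' B p q|.+2 & exists z, open_half C' B p q z].
Proof.
move=> pq cov pe lt op.
have [y E] : exists y, [set p; y] = e.
  have [a [b [_ E]]] := is_edgeP e2; move: pe; rewrite E !inE.
  by case/orP=> /eqP->; [exists b|exists a; rewrite setUC].
have npq := adj_neq sC pq.
have py : p != y by rewrite -is_edge2 E.
have yq : y != q by apply: contraTneq pq => <-; exact: new_not_old.
have qe : q \notin e by rewrite -E !inE negb_or (eq_sym q p) npq eq_sym.
have adjq x : adj C' q x = adj C q x.
  apply/idP/idP => [/adj'P[E2|//]|]; last exact: old.
  by move: qe; rewrite -E2 set21.
have adjp x : x != y -> adj C' p x -> adj C p x.
  move=> xy /adj'P[E2|//].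
  by rewrite (set2_injr (etrans E2 (esym E))) eqxx in xy.
have blS : #|blocked C B p q| <= #|blocked C' B p q|.
  apply/subset_leq_card/subsetP => x; rewrite !inE.
  by case/orP=> /andP[/old-> ->]; rewrite ?orbT.
have Ob := Bc pq (covering_old cov).
have le2 : #|pages C' p q| <= #|blocked C' B p q|.+2.
  have [qy|qy] := boolP (adj C q y).
    have pg : #|pages C p q| <= #|blocked C B p q|.+1.
      case: Ob => // -[_ /(_ y)]; rewrite /open_half eq_sym py yq qy new_not_old //=.
      by rewrite /adj E eB orbT.
    have : pages C' p q \subset y |: pages C p q.
      apply/subsetP => x; rewrite !inE adjq => /andP[px ->]; rewrite andbT.
      by have [//|xy] := eqVneq x y; rewrite adjp.
    move/subset_leq_card/leq_trans; apply; rewrite cardsU1.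
    by apply: leq_trans (leq_add (leq_b1 _) pg) _; rewrite add1n !ltnS.
  have : pages C' p q \subset pages C p q.
    apply/subsetP => x; rewrite !inE adjq => /andP[px qx]; rewrite qx andbT.
    by rewrite adjp //; apply: contraNneq qy => <-.
  move/subset_leq_card/leq_trans; apply.
  have : #|pages C p q| <= #|blocked C B p q|.+2 by case: Ob => [/leqW|[]].
  by move/leq_trans; apply; rewrite !ltnS.
(* A violation has at least two pages, so one of them was attached to [p] before the move and
   [spine_cond] supplies a blocked vertex. Hence there are in fact more than two pages. *)
have b0 : 0 < #|blocked C' B p q|.
  have /card_gt1P[x1 [x2 [x1P x2P x12]]] : 1 < #|pages C' p q| by apply: leq_ltn_trans lt.
  have [x xP xy] : exists2 x, x \in pages C' p q & x != y.
    have [x1y|] := eqVneq x1 y; last by exists x1.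
    by exists x2 => //; rewrite eq_sym -x1y.
  move: xP; rewrite inE adjq => /andP[/(adjp _ xy) px qx].
  have xq : x != q by ne.
  have [z zb] := Dc pq xq px (covering_old cov).
  by apply: leq_trans blS; rewrite card_gt0; apply/set0Pn; exists z.
by exists y; split=> //; [exact: leq_ltn_trans lt | apply: op].
Qed.

(** A new covering edge has at most one page, and an edge disjoint from [e] keeps its pages and
    halves. So the violating edge is old and meets [e]; its ends are renamed so that [p'] is the
    common vertex. *)
Lemma book_violation_edge p q : adj C' p q -> covering C' p q ->
  ~ (#|pages C' p q| <= #|blocked C' B p q|.+1 \/
     #|pages C' p q| <= #|blocked C' B p q|.+2 /\ forall x, ~~ open_half C' B p q x) ->
  exists p' q' y, [/\ adj C p' q', covering C' p' q', [set p'; y] = e & [set p'; q'] = [set p; q]] /\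
    [/\ y != q', 2 < #|pages C' p' q'|,
    #|pages C' p' q'| <= #|blocked C' B p' q'|.+2 & exists z, open_half C' B p' q' z].
Proof.
move=> pq cov nb.
have lt : #|blocked C' B p q|.+1 < #|pages C' p q|.
  by rewrite ltnNge; apply/negP => h; apply: nb; left.
have op : #|pages C' p q| <= #|blocked C' B p q|.+2 -> exists z, open_half C' B p q z.
  move=> le; apply: NNPP => no; apply: nb; right; split=> // x.
  by apply/negP => h; apply: no; exists x.
have [E|opq] := adj'P pq.
  have /card_gt1P[x1 [x2 []]] : 1 < #|pages C' p q| by apply: leq_ltn_trans lt.
  rewrite !inE => /andP[px1 qx1] /andP[px2 qx2] x12.
  by case: (new_covering_pages E cov x12).
have [pe|pe] := boolP (p \in e).
  have [y [? ? ? ? ?]] := book_violation_at opq cov pe lt op.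
  by exists p, q, y.
have [qe|qe] := boolP (q \in e).
  have [||||y [? ? ? ? ?]] := @book_violation_at q p _ _ qe.
  - by ad.
  - exact: coveringC.
  - by rewrite blockedC pagesC.
  - rewrite blockedC pagesC => /op[z hz]; exists z; by rewrite open_halfC.
  by exists q, p, y; split; split=> //; [ad | exact: coveringC | rewrite setUC].
have adjp x : adj C' p x = adj C p x.
  apply/idP/idP => [/adj'P[E2|//]|]; last exact: old.
  by move: pe; rewrite -E2 set21.
have adjq x : adj C' q x = adj C q x.
  apply/idP/idP => [/adj'P[E2|//]|]; last exact: old.
  by move: qe; rewrite -E2 set21.
exfalso; apply: nb.
have -> : pages C' p q = pages C p q by apply/setP => x; rewrite !inE adjp adjq.
have -> : blocked C' B p q = blocked C B p q by apply/setP => x; rewrite !inE adjp adjq.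
have [|[h1 h2]] := Bc opq (covering_old cov); [by left|right; split=> // x].
by rewrite /open_half adjp adjq; apply: h2.
Qed.

Lemma book_violation : ~ book_cond C' B ->
  exists p q y, [/\ adj C p q, covering C' p q & [set p; y] = e] /\
    [/\ y != q, 2 < #|pages C' p q|,
    #|pages C' p q| <= #|blocked C' B p q|.+2 & exists z, open_half C' B p q z].
Proof.
move=> nB; apply: NNPP => H; apply: nB => p q pq cov; apply: NNPP => nb; apply: H.
have [p' [q' [y [[h1 h2 h3 _] h4]]]] := book_violation_edge pq cov nb.
by exists p', q', y.
Qed.

(** The last clause says that [x] and [y] are the only pages of [u v]. *)
Definition diamond_bad u v x y := [/\ x != y, adj C' u v, adj C' u x & adj C' v x] /\
  [/\ adj C' u y, adj C' v y & forall z, z != x -> z != y -> adj C' u z -> adj C' v z -> False].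

Lemma diamond_badC u v x y : diamond_bad u v x y -> diamond_bad v u x y.
Proof.
case=> [[? ? ? ?] [? ? h]]; split; split=> //; first by ad.
by move=> z zx zy vz uz; apply: (h z).
Qed.

Lemma diamond_badCr u v x y : diamond_bad u v x y -> diamond_bad u v y x.
Proof.
case=> [[? ? ? ?] [? ? h]]; split; split=> //; first by ne.
by move=> z zx zy vz uz; apply: (h z).
Qed.

Lemma diamond_violation B2 : diamond_cond C B2 -> ~ diamond_cond C' B2 ->
  exists u v x y, [/\ diamond_bad u v x y, ~~ adj B2 x y &
    [set u; v] = e \/ [set u; x] = e].
Proof.
move=> Q2 nQ; apply: NNPP => H; apply: nQ => u v x y xy uv ux vx uy vy.
split; first by apply/negP => xy'; exact: (no_K4' uv ux vx uy vy xy').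
apply: NNPP => no.
have nB2 : ~~ adj B2 x y by apply/negP => h; apply: no; left.
have nB2' : ~~ adj B2 y x by rewrite adjC.
have bad : diamond_bad u v x y.
  split; split=> // z zx zy uz vz; apply: no; right; exists z; exact/and4P.
have [E|ouv] := adj'P uv; first by apply: H; exists u, v, x, y; split=> //; left.
have [E|oux] := adj'P ux; first by apply: H; exists u, v, x, y; split=> //; right.
have [E|ovx] := adj'P vx.
  by apply: H; exists v, u, x, y; split=> //; [exact: diamond_badC|right].
have [E|ouy] := adj'P uy.
  by apply: H; exists u, v, y, x; split=> //; [exact: diamond_badCr|right].
have [E|ovy] := adj'P vy.
  by apply: H; exists v, u, y, x; split=> //; [exact/diamond_badCr/diamond_badC|right].
have [_ [h|[z /and4P[h1 h2 /old h3 /old h4]]]] := Q2 u v x y xy ouv oux ovx ouy ovy.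
  by rewrite h in nB2.
by case: bad => [_ [_ _ /(_ z h1 h2 h3 h4)]].
Qed.

(** All violations ask for the same reply [x y]. Two with [e] as spine have the same two pages; any
    other two with distinct apex pairs would overlap in a [K_4], a fan, or a diamond with a third
    page. *)
Lemma diamond_bad_unique u v x y u' v' x' y' :
  diamond_bad u v x y -> [set u; v] = e \/ [set u; x] = e ->
  diamond_bad u' v' x' y' -> [set u'; v'] = e \/ [set u'; x'] = e ->
  [set x; y] = [set x'; y'].
Proof.
(* The new edge is the spine of one diamond and a side of the other. *)
have SP u1 v1 x1 y1 u2 v2 x2 y2 : diamond_bad u1 v1 x1 y1 -> diamond_bad u2 v2 x2 y2 ->
    [set u1; v1] = e -> [set u2; x2] = e -> False.
  wlog -> : u1 v1 / u1 = u2.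
    move=> H d1 d2 E1 E2; have /eqP := etrans E1 (esym E2).
    rewrite eq_set2 => /orP[]/andP[/eqP h1 /eqP h2].
      exact: (H u1 v1 h1 d1 d2 E1 E2).
    by apply: (H v1 u1 h2 (diamond_badC d1) d2 _ E2); rewrite setUC.
  move=> d1 d2 E1 E2; have h := set2_injr (etrans E1 (esym E2)); subst x2; clear E1 E2.
  wlog h : x1 y1 d1 / v2 = x1.
    move=> H; have [[xy uv ux vx] [uy vy no]] := d1.
    have [[xy2 uv2 _ vx2] [uy2 vy2 no2]] := d2.
    have [h|h1] := eqVneq v2 x1; first exact: (H x1 y1).
    have [h|h2] := eqVneq v2 y1; first exact: (H y1 x1 (diamond_badCr d1)).
    by apply: (no v2) => //; ad.
  subst v2; have [[xy uv ux vx] [uy vy no]] := d1.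
  have [[xy2 uv2 _ vx2] [uy2 vy2 no2]] := d2.
  have [h|h] := eqVneq y2 y1; first by subst y2; apply: (no_K4' uv ux vx uy vy).
  by apply: (@no_fan' u2 y2 x1 v1 y1); (ad || ne || idtac).
(* The new edge is a side of both diamonds, in the same or in the opposite direction. *)
have PP u1 v1 x1 y1 u2 v2 x2 y2 : diamond_bad u1 v1 x1 y1 -> diamond_bad u2 v2 x2 y2 ->
    [set u1; x1] = e -> [set u2; x2] = e -> [set x1; y1] = [set x2; y2].
  move=> [[xy uv ux vx] [uy vy no]] [[xy2 uv2 ux2 vx2] [uy2 vy2 no2]] E1 E2.
  have nxy : ~~ adj C' x1 y1 by apply/negP; apply: (no_K4' uv ux vx uy vy).
  have /eqP := etrans E1 (esym E2); rewrite eq_set2 => /orP[]/andP[/eqP h1 /eqP h2].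
    subst u2 x2; have [h|h] := eqVneq v1 v2.
      subst v2; have [->//|h] := eqVneq y2 y1.
      by case: (no y2) => //; ne.
    have h' : y1 != v2 by apply: contraNneq nxy => ->; ad.
    exfalso; apply: (@no_fan' u1 y1 v1 x1 v2); (ad || ne || idtac).
  subst u2 x2; exfalso; have [h|h] := eqVneq v1 v2.
    subst v2; have [h|h] := eqVneq y2 y1; first by subst y2; rewrite uy2 in nxy.
    by apply: (@no_fan' v1 y1 u1 x1 y2); (ad || ne || idtac).
  have h' : y1 != v2 by apply: contraNneq nxy => ->; ad.
  by apply: (@no_fan' u1 y1 v1 x1 v2); (ad || ne || idtac).
move=> d1 [E1|E1] d2 [E2|E2]; last exact: PP d1 d2 E1 E2.
- have [[xy uv ux vx] [uy vy no]] := d1.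
  have [[xy2 uv2 ux2 vx2] [uy2 vy2 no2]] := d2.
  have [ux2' vx2' uy2' vy2'] : [/\ adj C' u x', adj C' v x', adj C' u y' & adj C' v y'].
    have /eqP := etrans E1 (esym E2); rewrite eq_set2.
    by case/orP=> /andP[/eqP-> /eqP->].
  have mem z : adj C' u z -> adj C' v z -> z \in [set x; y].
    move=> uz vz; apply: contraT; rewrite !inE negb_or => /andP[zx zy].
    by case: (no z).
  have := mem _ ux2' vx2'; have := mem _ uy2' vy2'; rewrite !inE.
  case/orP=> /eqP h1; case/orP=> /eqP h2; subst; rewrite ?eqxx // in xy2 *.
  by rewrite setUC.
- by case: (SP _ _ _ _ _ _ _ _ d1 d2 E1 E2).
- by case: (SP _ _ _ _ _ _ _ _ d2 d1 E2 E1).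
Qed.

Lemma pair_violation B2 : pair_cond C B2 -> ~ pair_cond C' B2 ->
  exists s t c d, [/\ s != t, c != d, ~~ adj C' s t & [set s; c] = e] /\
   [/\ adj C' s c, adj C' t c, adj C' s d & adj C' t d] /\
   covering C' s t /\ ~~ adj B2 s t.
Proof.
move=> N2 nN; apply: NNPP => H; apply: nN => s t c d st cd nst sc tc sd td cov.
apply: contraT => nB2; exfalso; apply: H.
have nB2' : ~~ adj B2 t s by rewrite adjC.
have nst' : ~~ adj C' t s by rewrite adjC.
have cov' := coveringC cov.
have [E|osc] := adj'P sc; first by exists s, t, c, d.
have [E|otc] := adj'P tc; first by exists t, s, c, d; do ![split=> //]; ne.
have [E|osd] := adj'P sd; first by exists s, t, d, c; do ![split=> //]; ne.
have [E|otd] := adj'P td; first by exists t, s, d, c; do ![split=> //]; ne.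
case/negP: nB2; apply: (N2 s t c d) => //; last exact: covering_old.
by apply: contra nst; apply: old.
Qed.

(** * Incompatibility of the four kinds of violation *)

Lemma diamond_pair u v x y : diamond_bad u v x y -> [set u; v] = e \/ [set u; x] = e ->
  pair_cond C' B.
Proof.
case=> [[xy uv ux vx] _] [E|E].
  by apply: (pair_cond_triangle (w := x) E); ad.
by apply: (pair_cond_triangle (w := v) E); ad.
Qed.

(** If [e] is the spine [u v], it would be a new covering edge with two pages; if it is the side
    [u x], the edge [v y] misses it. *)
Lemma diamond_spine u v x y p q : diamond_bad u v x y ->
  [set u; v] = e \/ [set u; x] = e -> [set p; q] = e -> covering C' p q -> False.
Proof.
case=> [[xy uv ux vx] [uy vy no]] [E|E] E2 /(covering_set2 (etrans E2 (esym E))) cov.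
  exact: (new_covering_pages E cov xy).
have := cov v y; rewrite uv => /(_ isT vy).
case/or4P=> /eqP h; subst.
- exact: selfF uv.
- exact: selfF vx.
- exact: selfF uy.
- by rewrite eqxx in xy.
Qed.

(** If [p] is an end of the diamond's spine, covering forces [q] to be the other end, which leaves
    only two pages. If [p] is an apex, the other three vertices of the diamond form a triangle
    avoiding [p], and [q] cannot meet all its edges. *)
Lemma diamond_book u v x y p q y0 : diamond_bad u v x y ->
  [set u; v] = e \/ [set u; x] = e -> covering C' p q -> [set p; y0] = e ->
  2 < #|pages C' p q| -> False.
Proof.
move=> bad E cov E0 P.
have pK : [|| p == u, p == v, p == x | p == y].
  have pe : p \in e by rewrite -E0 set21.
  by case: E pe => <-; rewrite !inE => /orP[]->; rewrite ?orbT.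
have spine u1 v1 x1 y1 : diamond_bad u1 v1 x1 y1 -> p == u1 -> False.
  move=> [[xy uv ux vx] [uy vy no]] /eqP ?; subst u1.
  have h1 := cov v1 x1; rewrite uv in h1; have {}h1 := h1 isT vx.
  have h2 := cov v1 y1; rewrite uv in h2; have {}h2 := h2 isT vy.
  have qv : q = v1 -> False.
    move=> ?; subst q; have [z [uz vz zx zy]] := page_avoid x1 y1 P.
    exact: (no z).
  case/or4P: h1 => /eqP h; [by move: uv; rewrite h => /(selfF sC') | exact: qv | by move: ux; rewrite h => /(selfF sC') |].
  case/or4P: h2 => /eqP h'; [by move: uv; rewrite h' => /(selfF sC') | exact: qv | by move: uy; rewrite h' => /(selfF sC') |].
  by rewrite h h' eqxx in xy.
have page u1 v1 x1 y1 : diamond_bad u1 v1 x1 y1 -> p == x1 -> False.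
  move=> [[xy uv ux vx] [uy vy no]] /eqP ?; subst x1.
  have h1 := cov u1 y1; rewrite (adjC _ p) ux in h1; have {h1} := h1 isT uy.
  have h2 := cov v1 y1; rewrite (adjC _ p) vx in h2; have {h2} := h2 isT vy.
  have h3 := cov u1 v1; rewrite (adjC _ p) ux in h3; have {h3} := h3 isT uv.
  have nxu : u1 == p = false by apply: contraTF ux => /eqP->; apply/negP; apply: selfF.
  have nxv : v1 == p = false by apply: contraTF vx => /eqP->; apply/negP; apply: selfF.
  rewrite nxu nxv (eq_sym y1) (negPf xy) /=.
  case/orP=> /eqP h; subst.
  - rewrite (eq_sym v1) (negPf (adj_neq sC' uv)) /=.
    by move=> /eqP h; subst; case: (selfF sC' uy).
  - rewrite (negPf (adj_neq sC' uv)) /= => _ /eqP h; subst; exact: (selfF sC' vy).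
have bad' := diamond_badCr bad.
case/or4P: pK => h.
- exact: spine bad h.
- exact: spine (diamond_badC bad) h.
- exact: page bad h.
- exact: page bad' h.
Qed.

(** The edge [t d] misses [s c]. *)
Lemma pair_spine s t c d p q : s != t -> c != d -> ~~ adj C' s t -> [set s; c] = e ->
  adj C' s c -> adj C' t c -> adj C' s d -> adj C' t d ->
  [set p; q] = e -> covering C' p q -> False.
Proof.
move=> st cd nst E sc tc sd td E2 /(covering_set2 (etrans E2 (esym E))) cov.
have := cov t d; rewrite (adjC _ c) tc orbT => /(_ isT td).
case/or4P=> /eqP h; subst.
- by rewrite eqxx in st.
- exact: selfF tc.
- exact: selfF sd.
- by rewrite eqxx in cd.
Qed.

(** By [pair_cond_triangle], [e] lies in no triangle. If [p = s], the edge [c t] would have to meet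
    [q], but neither [q = c] nor [q = t] is possible. If [p = c], the edge [s d] forces [q = d],
    which gives a triangle on [e]. *)
Lemma pair_book s t c d p q y : s != t -> c != d -> ~~ adj C' s t -> [set s; c] = e ->
  adj C' s c -> adj C' t c -> adj C' s d -> adj C' t d ->
  covering C' s t -> ~~ adj B s t ->
  adj C p q -> covering C' p q -> [set p; y] = e -> False.
Proof.
move=> st cd nst E sc tc sd td cst nB pq cov E2.
have notri w : adj C' w s -> adj C' w c -> False.
  move=> ws wc; case/negP: nB.
  exact: (pair_cond_triangle E ws wc st cd).
have npq : [set p; q] != e by apply: contraTneq pq => /new_not_old.
have /eqP := etrans E2 (esym E); rewrite eq_set2 => /orP[]/andP[/eqP h1 /eqP h2].
- subst p y; have := cov c t; rewrite sc => /(_ isT); rewrite (adjC _ c) => /(_ tc).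
  case/or4P=> /eqP h.
  + by move: sc; rewrite h => /(selfF sC').
  + by rewrite -h E eqxx in npq.
  + by rewrite h eqxx in st.
  + by rewrite h (old pq) in nst.
- subst p y; have := cov s d; rewrite (adjC _ c) sc => /(_ isT sd).
  case/or4P=> /eqP h.
  + by move: sc; rewrite h => /(selfF sC').
  + by rewrite -h setUC E eqxx in npq.
  + by rewrite h eqxx in cd.
  + by apply: (notri d); [ad | rewrite h adjC; apply: old].
Qed.

(** The edge from [q] to a page other than [y] misses [e]. *)
Lemma book_spine p q y p' q' : adj C p q -> [set p; y] = e -> 2 < #|pages C' p q| ->
  [set p'; q'] = e -> covering C' p' q' -> False.
Proof.
move=> pq E P E2 /(covering_set2 (etrans E2 (esym E))) cov.
have [x [px qx xy _]] := page_avoid y y P.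
have := cov q x; rewrite (old pq) => /(_ isT qx).
case/or4P=> /eqP h.
- by move: pq; rewrite h => /(selfF sC).
- by case/negP: (new_not_old E); rewrite -h.
- by move: px; rewrite h => /(selfF sC').
- by rewrite h eqxx in xy.
Qed.

(** This lemma and the next three together show that one move breaks at most one local condition, so
    that a reply may be devoted to that one; the others survive because they are monotone in
    Blocker's graph. *)
Lemma diamond_only : ~ diamond_cond C' B ->
  [/\ pair_cond C' B, spine_cond C' B & book_cond C' B].
Proof.
move=> /(diamond_violation Qc)[u [v [x [y [bad _ E]]]]]; split.
- exact: diamond_pair bad E.
- apply: NNPP => /(spine_violation sB Dc)[p [q [w [Epq cov _ _ _]]]].
  exact: (diamond_spine bad E Epq cov).
- apply: NNPP => /book_violation[p [q [y0 [[_ cov Ep] [_ P _ _]]]]].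
  exact: (diamond_book bad E cov Ep P).
Qed.

Lemma pair_only : ~ pair_cond C' B ->
  [/\ spine_cond C' B, book_cond C' B & diamond_cond C' B].
Proof.
move=> nN; split; last by apply: NNPP => /diamond_only[/nN].
- apply: NNPP => /(spine_violation sB Dc)[p [q [w [Epq cov _ _ _]]]].
  have [s [t [c [d [[st cd nst E] [[sc tc sd td] [cst nB]]]]]]] := pair_violation Nc nN.
  exact: (pair_spine st cd nst E sc tc sd td Epq cov).
- apply: NNPP => /book_violation[p [q [y0 [[pq cov Ep] [_ P _ _]]]]].
  have [s [t [c [d [[st cd nst E] [[sc tc sd td] [cst nB]]]]]]] := pair_violation Nc nN.
  exact: (pair_book st cd nst E sc tc sd td cst nB pq cov Ep).
Qed.

Lemma book_only : ~ book_cond C' B ->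
  [/\ pair_cond C' B, spine_cond C' B & diamond_cond C' B].
Proof.
move=> nB; split.
- by apply: NNPP => /pair_only[_ /nB].
- have [p [q [y0 [[pq cov Ep] [_ P _ _]]]]] := book_violation nB.
  apply: NNPP => /(spine_violation sB Dc)[p' [q' [w [Epq cov' _ _ _]]]].
  exact: (book_spine pq Ep P Epq cov').
- by apply: NNPP => /diamond_only[_ _ /nB].
Qed.

Lemma spine_only : ~ spine_cond C' B ->
  [/\ pair_cond C' B, book_cond C' B & diamond_cond C' B].
Proof.
move=> nD; split.
- by apply: NNPP => /pair_only[/nD].
- by apply: NNPP => /book_only[_ /nD].
- by apply: NNPP => /diamond_only[_ /nD].
Qed.

(** Blocker can repair only one book. With the same end of [e] in both spines, the edge from [q] to
    a page forces [q = q']. With opposite ends, [p q] forces [q = q'], and then an edge from [p] to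
    another page misses the second spine. *)
Lemma book_unique p q y p' q' y' : adj C p q -> [set p; y] = e -> y != q ->
  2 < #|pages C' p q| -> adj C p' q' -> covering C' p' q' -> [set p'; y'] = e ->
  [set p; q] = [set p'; q'].
Proof.
move=> pq E yq P pq' cov E'.
have /eqP := etrans E (esym E'); rewrite eq_set2 => /orP[]/andP[/eqP h1 /eqP h2].
  subst p' y'; have [x [px qx xq' _]] := page_avoid q' q' P.
  have := cov q x; rewrite (old pq) => /(_ isT qx).
  case/or4P=> /eqP h.
  - by move: pq; rewrite h => /(selfF sC).
  - by rewrite h.
  - by move: px; rewrite h => /(selfF sC').
  - by rewrite h eqxx in xq'.
subst p' y'; have yp : adj C' y p by rewrite adjC; apply: newE.
have [x [px qx xy _]] := page_avoid y y P.
have npy := adj_neq sC' yp; have npq := adj_neq sC pq.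
have qq : q = q'.
  have := cov p q; rewrite yp => /(_ isT (old pq)); case/or4P=> /eqP h.
  - by rewrite h eqxx in npy.
  - by case/negP: (new_not_old E); rewrite h adjC.
  - by rewrite h eqxx in yq.
  - by [].
subst q'; have := cov p x; rewrite yp => /(_ isT px); case/or4P=> /eqP h.
- by rewrite h eqxx in npy.
- by rewrite h eqxx in npq.
- by rewrite h eqxx in xy.
- by move: qx; rewrite h => /(selfF sC').
Qed.

(** The last clause places [f] in the component of [e], which is what keeps the edge counts
    balanced. *)
Definition reply f := [/\ is_edge f, f \notin C', f \notin B &
  forall K, adj_closed C' K -> e \subset K -> f \subset K].
Definition local_cond B2 := [/\ pair_cond C' B2, spine_cond C' B2, book_cond C' B2 &
  diamond_cond C' B2].

(** * Blocker's answer to each kind of violation *)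

Lemma reply_diamond : ~ diamond_cond C' B ->
  exists f, reply f /\ local_cond (f |: B).
Proof.
move=> nQ; have [hN hD hB] := diamond_only nQ.
have [u [v [x [y [bad nB E]]]]] := diamond_violation Qc nQ.
have [[xy uv ux vx] [uy vy no]] := bad.
have sBf : B \subset [set x; y] |: B := subsetUr _ _.
exists [set x; y]; split.
  split; [by rewrite is_edge2 | | exact: nB |].
  - apply/negP; exact: no_K4' uv ux vx uy vy.
  - move=> K cK eK; have uK : u \in K.
      by case: E eK => <-; rewrite subUset !sub1set => /andP[].
    by rewrite subUset !sub1set (cK u x) // (cK u y).
split; [exact: pair_condS hN | exact: spine_condS hD | exact: book_condS hB |].
apply: NNPP => /(diamond_violation (diamond_condS sBf Qc)).
move=> [u2 [v2 [x2 [y2 [bad2 /negP nB2 E2]]]]]; apply: nB2.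
by rewrite /adj -(diamond_bad_unique bad E bad2 E2) setU11.
Qed.

Lemma reply_pair : ~ pair_cond C' B -> exists f, reply f /\ local_cond (f |: B).
Proof.
move=> nN; have [hD hB hQ] := pair_only nN.
have [s [t [c [d [[st cd nst E] [[sc tc sd td] [cov nB]]]]]]] := pair_violation Nc nN.
have sBf : B \subset [set s; t] |: B := subsetUr _ _.
exists [set s; t]; split.
  split; [by rewrite is_edge2 | exact: nst | exact: nB |].
  move=> K cK eK; have sK : s \in K.
    by move: eK; rewrite -E subUset !sub1set => /andP[].
  by rewrite subUset !sub1set sK (cK c t) //; [exact: (cK s c) | ad].
split; [| exact: spine_condS hD | exact: book_condS hB | exact: diamond_condS hQ].
apply: NNPP => /(pair_violation (pair_condS sBf Nc)).
move=> [s2 [t2 [c2 [d2 [[st2 cd2 nst2 E2] [[sc2 tc2 sd2 td2] [cov2 nB2]]]]]]].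
have /eqP := etrans E (esym E2); rewrite eq_set2 => /orP[]/andP[/eqP h1 /eqP h2].
  subst s2 c2; have := cov2 c t; rewrite sc (adjC _ c) => /(_ isT tc).
  case/or4P=> /eqP h.
  - by move: sc; rewrite h => /(selfF sC').
  - by move: tc2; rewrite h => /(selfF sC').
  - by rewrite h eqxx in st.
  - by move: nB2; rewrite -h /adj setU11.
(* Two violations using [e] in opposite directions make the 4-cycle [s c t d] a whole component. Its
   three old edges force an edge of Blocker on these vertices by [count_cond], whereas both
   diagonals are unclaimed. *)
subst s2 c2; have sc' : adj C' c s by ad.
have dt2 : d = t2.
  have := cov2 s d; rewrite sc' => /(_ isT sd); case/or4P=> /eqP h.
  - by move: sc; rewrite h => /(selfF sC').
  - by move: tc2; rewrite h => /(selfF sC').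
  - by rewrite h eqxx in cd.
  - by [].
subst t2; pose K := [set s; t; c; d].
have ncd : ~~ adj B c d.
  by apply: contra nB2; apply: adj_sub.
have cK : adj_closed C' K.
  have nc z : adj C' c z -> z \in K.
    move=> cz; have := cov c z; rewrite sc => /(_ isT cz).
    by rewrite (negPf (adj_neq sC' sc')) eq_sym (negPf (adj_neq sC' tc)) /= !inE => /orP[]->; rewrite ?orbT.
  have nd z : adj C' d z -> z \in K.
    move=> dz; have := cov d z; rewrite sd => /(_ isT dz).
    by rewrite eq_sym (negPf (adj_neq sC' sd)) eq_sym (negPf (adj_neq sC' td)) /= !inE => /orP[]->; rewrite ?orbT.
  have ns z : adj C' s z -> z \in K.
    move=> sz; have := cov2 s z; rewrite sc' => /(_ isT sz).
    by rewrite (negPf (adj_neq sC' sc)) (negPf (adj_neq sC' sd)) /= !inE => /orP[]->; rewrite ?orbT.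
  have nt z : adj C' t z -> z \in K.
    move=> tz; have := cov2 t z; rewrite (adjC _ c) tc => /(_ isT tz).
    by rewrite (negPf (adj_neq sC' tc)) (negPf (adj_neq sC' td)) /= !inE => /orP[]->; rewrite ?orbT.
  move=> x z xK; have : [|| x == s, x == t, x == c | x == d] by move: xK; rewrite !inE -!orbA.
  by case/or4P=> /eqP->; [exact: ns|exact: nt|exact: nc|exact: nd].
have K4 : #|K| <= 4.
  have KE : K =i [:: s; t; c; d] by move=> z; rewrite !inE -!orbA.
  by rewrite (eq_card KE) (leq_trans (card_size _)).
have C3 : 2 < #|inner C K|.
  have otc : adj C t c by apply: (old1 E) => //; ne.
  have osd : adj C d s by apply: (old1 E); [ne|ne|ad].
  have otd : adj C t d by apply: (old1 E) => //; ne.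
  have U : uniq [:: [set t; c]; [set d; s]; [set t; d]].
    have n1 := adj_neq sC' td; have n2 := adj_neq sC' tc; have n3 := adj_neq sC' sd.
    by distinct_edges.
  apply: (inner_ge U); rewrite /= !subUset !sub1set !inE !eqxx ?orbT !andbT.
  exact/and3P.
have h : 0 < #|inner B K|.
  have := Cc (closed_old cK) (leqW K4).
  have := half_leq K4; rewrite /= => k2 le.
  by have := leq_trans C3 (leq_trans le (leq_add (leqnn _) k2)); rewrite addn2 !ltnS.
move: h; rewrite card_gt0 => /set0Pn[g]; rewrite inE => /andP[gB].
have [x [z [xz gxz]]] := is_edgeP (sB gB).
have bxz : adj B x z by rewrite /adj -gxz.
have tc' : adj C' c t by ad.
have sd' : adj C' d s by ad.
have td' : adj C' d t by ad.
have nts : ~~ adj B t s by rewrite adjC.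
have ndc : ~~ adj B d c by rewrite adjC.
rewrite gxz subUset !sub1set !inE -!orbA => /andP[/or4P[]/eqP hx /or4P[]/eqP hz]; subst x z.
all: try by move: bxz => /(selfF sB).
all: try by (apply: disj' bxz).
all: try by apply/negP: bxz.
Qed.

Lemma open_half_reply p q z : adj C' p q -> open_half C' B p q z ->
  exists f, [/\ is_edge f, f \notin C', f \notin B & z \in blocked C' (f |: B) p q] /\
    [/\ z \notin blocked C' B p q & forall K, adj_closed C' K -> p \in K -> f \subset K].
Proof.
move=> pq /and3P[zp zq /orP[]/and3P[h1 h2 h3]].
- exists [set q; z]; split; split=> //; rewrite ?inE ?h1 ?negb_or ?negb_and ?h2 ?h3 //.
  + by rewrite is_edge2 eq_sym.
  + by rewrite /adj setU11.
  + by move=> K cK pK; rewrite subUset !sub1set (cK p q) // (cK p z).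
- exists [set p; z]; split; split=> //; rewrite ?inE ?h1 ?negb_or ?negb_and ?h2 ?h3 ?orbT //.
  + by rewrite is_edge2 eq_sym.
  + by rewrite /adj setU11 orbT.
  + by move=> K cK pK; rewrite subUset !sub1set pK (cK q z) // (cK p q).
Qed.

(** Closing an open half adds a blocked vertex, which restores the first alternative of [book_cond].
    By [book_unique] no second book is in need. *)
Lemma reply_book : ~ book_cond C' B -> exists f, reply f /\ local_cond (f |: B).
Proof.
move=> nB; have [hN hD hQ] := book_only nB.
have [p [q [y [[pq cov E] [yq P le [z oz]]]]]] := book_violation nB.
have [f [[f2 fC fB zb] [zb' fK]]] := open_half_reply (old pq) oz.
have sBf : B \subset f |: B := subsetUr _ _.
exists f; split.
  split=> // K cK eK; apply: fK => //.
  by move: eK; rewrite -E subUset !sub1set => /andP[].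
split; [exact: pair_condS hN | exact: spine_condS hD | | exact: diamond_condS hQ].
have lt u v : [set p; q] = [set u; v] ->
    #|pages C' u v| <= #|blocked C' (f |: B) u v|.+1.
  move=> Euv; suff H : #|pages C' p q| <= #|blocked C' (f |: B) p q|.+1.
    have /eqP := Euv; rewrite eq_set2 => /orP[]/andP[/eqP h1 /eqP h2]; subst p q => //.
    by rewrite pagesC blockedC.
  apply: leq_trans le _; rewrite ltnS.
  apply: (@leq_trans #|z |: blocked C' B p q|); first by rewrite cardsU1 zb'.
  by apply/subset_leq_card; rewrite subUset sub1set zb; exact: blockedS.
move=> u v uv cuv; apply: NNPP => H.
have [|p' [q' [y' [[pq' cov' E' Euv] _]]]] := book_violation_edge uv cuv.
  case=> [h|[h1 h2]]; apply: H; [left|right].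
    by apply: leq_trans h _; rewrite ltnS subset_leq_card // blockedS.
  split; first by apply: leq_trans h1 _; rewrite !ltnS subset_leq_card // blockedS.
  by move=> x; apply: contra (h2 x); apply: open_halfS.
apply: H; left; apply: lt; rewrite -Euv.
exact: (book_unique pq E yq P pq' cov' E').
Qed.

(** With neither blocked vertices nor open halves, every further neighbour of [p] or [q] is a page,
    and a new covering edge has only one. The component is then a triangle with two old edges, and
    [count_cond] would give Blocker an edge inside it. *)
Lemma spine_open p q w : [set p; q] = e -> covering C' p q ->
  (forall x, x \notin blocked C' B p q) -> w != q -> adj C' p w ->
  exists z, open_half C' B p q z.
Proof.
move=> E cov nb wq pw; apply: NNPP => no.
have pq := newE E; have npq := adj_neq sC' pq.
have both x : x != p -> x != q -> adj C' p x || adj C' q x -> adj C' p x && adj C' q x.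
  move=> xp xq h; apply: contraT => h'; case: no; exists x; rewrite /open_half xp xq.
  move: (nb x); rewrite inE negb_or !negb_and.
  by case: (adj C' p x) h h' => /=; case: (adj C' q x) => //= _ _; rewrite ?orbF ?andbT.
have wp : w != p by ne.
have qw : adj C' q w by have := both w wp wq; rewrite pw => /(_ isT).
have un x : adj C' p x -> adj C' q x -> x = w.
  move=> px qx; apply/eqP; apply: contraT => xw.
  by case: (new_covering_pages E cov xw px qx pw qw).
pose K := [set p; q; w].
have cK : adj_closed C' K.
  have np x : adj C' p x -> x \in K.
    move=> px; rewrite !inE; have xp : x != p by ne.
    have [//|xq] := eqVneq x q; first by rewrite orbT.
    have := both x xp xq; rewrite px => /(_ isT)/andP[_ qx].
    by rewrite (un x px qx) eqxx orbT.
  have nq x : adj C' q x -> x \in K.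
    move=> qx; rewrite !inE; have xq : x != q by ne.
    have [//|xp] := eqVneq x p.
    have := both x xp xq; rewrite qx orbT => /(_ isT)/andP[px _].
    by rewrite (un x px qx) eqxx orbT.
  move=> x z xK xz; have : [|| x == p, x == q | x == w] by move: xK; rewrite !inE -!orbA.
  case/or3P=> /eqP h; subst x; [exact: np|exact: nq|].
  have := cov w z; rewrite pw => /(_ isT xz); rewrite (negPf wp) (negPf wq) /= !inE.
  by case/orP=> ->; rewrite ?orbT.
have K3 : #|K| <= 3.
  have KE : K =i [:: p; q; w] by move=> z; rewrite !inE -!orbA.
  by rewrite (eq_card KE) (leq_trans (card_size _)).
have C2 : 1 < #|inner C K|.
  have U : uniq [:: [set w; p]; [set w; q]] by distinct_edges.
  apply: (inner_ge U); rewrite /= !subUset !sub1set !inE !eqxx ?orbT !andbT.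
  by apply/andP; split; apply: (old1 E) => //; ad.
have h : 0 < #|inner B K|.
  have := Cc (closed_old cK) (leq_trans K3 (isT : 3 <= 5)).
  have := half_leq K3; rewrite /= => k2 le.
  by have := leq_trans C2 (leq_trans le (leq_add (leqnn _) k2)); rewrite addn1 !ltnS.
move: h; rewrite card_gt0 => /set0Pn[g]; rewrite inE => /andP[gB].
have [x [z [xz gxz]]] := is_edgeP (sB gB).
have bxz : adj B x z by rewrite /adj -gxz.
have qp' : adj C' q p by ad.
have wp' : adj C' w p by ad.
have wq' : adj C' w q by ad.
rewrite gxz subUset !sub1set !inE -!orbA => /andP[/or3P[]/eqP hx /or3P[]/eqP hz]; subst x z.
all: try by move: bxz => /(selfF sB).
all: by apply: disj' bxz.
Qed.

Lemma reply_spine : ~ spine_cond C' B -> exists f, reply f /\ local_cond (f |: B).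
Proof.
move=> nD; have [hN hB hQ] := spine_only nD.
have [p [q [w [E cov nb wq pw]]]] := spine_violation sB Dc nD.
have [z oz] := spine_open E cov nb wq pw.
have [f [[f2 fC fB zb] [zb' fK]]] := open_half_reply (newE E) oz.
have sBf : B \subset f |: B := subsetUr _ _.
exists f; split.
  split=> // K cK eK; apply: fK => //.
  by move: eK; rewrite -E subUset !sub1set => /andP[].
split; [exact: pair_condS hN | | exact: book_condS hB | exact: diamond_condS hQ].
have sBf2 : simple (f |: B) by move=> g; rewrite in_setU1 => /orP[/eqP->|/sB].
apply: NNPP => /(spine_violation sBf2 (spine_condS sBf Dc)).
move=> [p2 [q2 [w2 [E2 _ nb2 _ _]]]].
have /eqP := etrans E (esym E2); rewrite eq_set2 => /orP[]/andP[/eqP h1 /eqP h2].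
  by move: (nb2 z); rewrite -h1 -h2 zb.
by move: (nb2 z); rewrite -h1 -h2 blockedC zb.
Qed.

Lemma local_reply : local_cond B \/ exists f, reply f /\ local_cond (f |: B).
Proof.
have [hN|/reply_pair] := classic (pair_cond C' B); last by right.
have [hD|/reply_spine] := classic (spine_cond C' B); last by right.
have [hB|/reply_book] := classic (book_cond C' B); last by right.
have [hQ|/reply_diamond] := classic (diamond_cond C' B); last by right.
by left; split.
Qed.

(** * Balance of the edge counts in small components *)

Lemma count_reply f : reply f -> count_cond C' (f |: B).
Proof.
move=> [f2 fC fB fK] K cK K5; have le := Cc (closed_old cK) K5.
have [eK|eK] := boolP (e \subset K).
  have : #|inner C' K| <= #|inner C K|.+1 by exact: inner_new_le.
  move/leq_trans; apply.
  have -> : inner (f |: B) K = f |: inner B K.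
    apply/setP => g; rewrite !inE; have [->|] //= := eqVneq g f.
    exact: fK.
  by rewrite cardsU1 inE (negPf fB) /= add1n addSn ltnS.
have -> : inner C' K = inner C K.
  apply/setP => g; rewrite !inE; have [->|] //= := eqVneq g e.
  by rewrite (negPf eK) andbF.
by apply: leq_trans le _; rewrite leq_add2r subset_leq_card // innerS // subsetUr.
Qed.

Lemma inner_new_notin (K : {set 'I_n}) : ~~ (e \subset K) -> inner C' K = inner C K.
Proof.
move=> eK; apply/setP => g; rewrite !inE; have [->|] //= := eqVneq g e.
by rewrite (negPf eK) andbF.
Qed.

(** If no reply exists, all pairs in the component [K0] of [e] are claimed and [parity_bound]
    recovers the unit lost by the move. The rest [D] of [K] does not contain [e], so its old bound
    persists. *)
Lemma count_full : (forall f, ~ reply f) -> count_cond C' B.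
Proof.
move=> nf K cK K5; have [eK|eK] := boolP (e \subset K); last first.
  by rewrite inner_new_notin //; apply: Cc => //; exact: closed_old.
have [a [b [ab E]]] := is_edgeP e2.
pose K0 := [set y | connect (adj C') a y]; pose D := K :\: K0.
have conK (X : {set 'I_n}) y : adj_closed C' X -> a \in X -> connect (adj C') a y -> y \in X.
  move=> cX aX /connectP[p]; elim: p (a) aX => [|z p IH] x xX /=; first by move=> _ ->.
  by case/andP=> xz; apply: IH; apply: cX xz.
have cK0 : adj_closed C' K0.
  by move=> x y; rewrite !inE => ax xy; apply: connect_trans ax (connect1 xy).
have aK0 : a \in K0 by rewrite inE connect0.
have bK0 : b \in K0 by apply: cK0 aK0 _; apply: newE.
have sK0 : K0 \subset K.
  apply/subsetP => y; rewrite inE; apply: conK => //.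
  by apply: (subsetP eK); rewrite E set21.
have cD : adj_closed C' D.
  move=> x y; rewrite !in_setD => /andP[xK0 xK] xy; rewrite (cK x y) // andbT.
  by apply: contra xK0 => yK0; apply: (cK0 y) => //; ad.
have KD : #|K| = #|K0| + #|D|.
  by rewrite -(cardsID K0 K); congr (#|pred_of_set _| + _); apply/setIidPr.
have le5 : #|K0| <= 5 by rewrite (leq_trans _ K5) // KD leq_addr.
have leD5 : #|D| <= 5 by rewrite (leq_trans _ K5) // KD leq_addl.
have eD : ~~ (e \subset D).
  by rewrite E subUset sub1set in_setD aK0.
have hD : #|inner C' D| <= #|inner B D| + #|D|./2.
  by rewrite inner_new_notin //; apply: Cc => //; exact: closed_old.
have full : inner (C' :|: B) K0 = [set g : {set 'I_n} | g \subset K0 & #|g| == 2].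
  apply/setP => g; rewrite [LHS]inE [RHS]inE andbC; have [gK|] //= := boolP (g \subset K0).
  apply/idP/idP => [|g2]; first by rewrite inE => /orP[/sC'|/sB].
  apply: contraT; rewrite inE negb_or => /andP[gC gB]; case: (nf g); split=> // X cX eX.
  apply: subset_trans gK _; apply/subsetP => y; rewrite inE; apply: conK => //.
  by apply: (subsetP eX); rewrite E set21.
have h0 : #|inner C' K0| <= #|inner B K0| + #|K0|./2.
  apply: parity_bound => //; first by rewrite inner_disjoint full cards_draws.
  apply: leq_trans (inner_new_le K0) _; rewrite ltnS; apply: Cc => //; exact: closed_old.
have hC : #|inner C' K| <= #|inner C' K0| + #|inner C' D|.
  apply: (leq_trans _ (leq_card_setU _ _)); apply/subset_leq_card/subsetP => g.
  rewrite inE => /andP[gC gK].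
  rewrite in_setU [g \in inner _ K0]inE [g \in inner _ D]inE gC /=.
  have [x [y [xy Eg]]] := is_edgeP (sC' gC); subst g.
  move: gK; rewrite !subUset !sub1set => /andP[xK yK].
  have [xK0|xK0] := boolP (x \in K0); first by rewrite (cK0 x y).
  apply/orP; right; rewrite !in_setD xK yK xK0 /= andbT.
  by apply: contra xK0 => yK0; apply: (cK0 y) => //; rewrite adjC.
have hB : #|inner B K0| + #|inner B D| <= #|inner B K|.
  rewrite -cardsUI; have -> : inner B K0 :&: inner B D = set0.
    apply/setP => g; rewrite !inE; apply/negP => /andP[/andP[gB gK0] /andP[_ gD]].
    have [x [y [xy Eg]]] := is_edgeP (sB gB); subst g.
    move: gK0 gD; rewrite !subUset !sub1set => /andP[xK0 _] /andP[].
    by rewrite in_setD xK0.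
  rewrite cards0 addn0; apply/subset_leq_card/subsetP => g; rewrite !inE.
  case/orP=> /andP[-> h] /=; first exact: subset_trans sK0.
  exact: subset_trans h (subsetDl _ _).
apply: leq_trans hC _; apply: leq_trans (leq_add h0 hD) _.
rewrite addnACA; apply: leq_add hB _.
(* The halves are rounded down, so their sum is at most the half for [K]. *)
by rewrite KD halfD leq_addl.
Qed.

End Step.

(** * The invariant of Blocker's strategy *)

Section Good.
Context {n : nat}.
Implicit Types (C B : graph n).

Definition good C B := [/\ simple C, simple B, forall f, f \in C -> f \notin B,
    P6_free C & count_cond C B] /\
  [/\ pair_cond C B, spine_cond C B, book_cond C B & diamond_cond C B].

Lemma good_add C B f : good C B -> f \in unclaimed C B -> good C (f |: B).
Proof.
move=> [[sC sB d F c] [hN hD hB hQ]]; rewrite inE => /and3P[f2 fC fB].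
have sBf : B \subset f |: B := subsetUr _ _.
split; split=> //.
- by move=> g; rewrite in_setU1 => /orP[/eqP->|/sB].
- move=> g gC; rewrite in_setU1 negb_or d // andbT.
  by apply: contraNneq fC => <-.
- exact: count_condS c.
- exact: pair_condS hN.
- exact: spine_condS hD.
- exact: book_condS hB.
- exact: diamond_condS hQ.
Qed.

Lemma good0 : good set0 set0.
Proof.
have no (x y : 'I_n) : adj set0 x y -> False by rewrite /adj inE.
split; split; try by move=> f; rewrite inE.
- by apply: P6_freeI => a b c d f g _ /no.
- move=> K _ _; have -> : inner set0 K = set0 :> graph n.
    by apply/setP => g; rewrite !inE.
  by rewrite cards0.
- by move=> u v x y _ _ _ /no.
- by move=> u v w /no.
- by move=> u v /no.
- by move=> u v x y _ /no.
Qed.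

(** Even when no local condition is broken Blocker answers in the component of [e], for the sake of
    the edge balance. Only if that component is full does he play elsewhere, or find the game
    over. *)
Lemma good_reply C B e : good C B -> e \in cmoves C B ->
  (exists2 f, f \in unclaimed (e |: C) B & good (e |: C) (f |: B)) \/
  unclaimed (e |: C) B = set0 /\ good (e |: C) B.
Proof.
move=> [[sC sB d F c] [hN hD hB hQ]]; rewrite !inE => /andP[/and3P[e2 eC eB] F'].
have sC' : simple (e |: C) by move=> g; rewrite in_setU1 => /orP[/eqP->|/sC].
have d' g : g \in e |: C -> g \notin B by rewrite in_setU1 => /orP[/eqP->|/d].
have [loc|[f [rf [lN lD lB lQ]]]] := local_reply sC sB d c hN hD hB hQ e2 eC eB F'.
  have [g2|nog] := classic (exists f, reply C B e f).
    have [f rf] := g2; have [f2 fC fB _] := rf.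
    have fu : f \in unclaimed (e |: C) B by rewrite inE f2 fC.
    left; exists f => //; have sBf : B \subset f |: B := subsetUr _ _.
    have [lN lD lB lQ] := loc; split; split=> //.
    - by move=> g; rewrite in_setU1 => /orP[/eqP->|/sB].
    - move=> g gC; rewrite in_setU1 negb_or d' // andbT.
      by apply: contraNneq fC => <-.
    - exact: (count_reply c e2 eC eB F' rf).
    - exact: pair_condS lN.
    - exact: spine_condS lD.
    - exact: book_condS lB.
    - exact: diamond_condS lQ.
  have G : good (e |: C) B.
    split; split=> //; try by case: loc.
    apply: count_full => // f rf; apply: nog; by exists f.
  have [E0|[f fu]] := set_0Vmem (unclaimed (e |: C) B); first by right.
  by left; exists f => //; exact: good_add.
have [f2 fC fB _] := rf.
left; exists f; first by rewrite inE f2 fC.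
split; split=> //.
- by move=> g; rewrite in_setU1 => /orP[/eqP->|/sB].
- move=> g gC; rewrite in_setU1 negb_or d' // andbT.
  by apply: contraNneq fC => <-.
- exact: (count_reply c e2 eC eB F' rf).
Qed.
End Good.

(** * Counting triangles *)

Section Triangles.
Context {n : nat}.
Implicit Types (X C B : graph n) (a b c x y z : 'I_n) (T K : {set 'I_n}).

Definition is_triangle X T := (#|T| == 3) &&
  [forall x in T, forall y in T, (x != y) ==> ([set x; y] \in X)].

Lemma trianglesE X : triangles X = #|[set T | is_triangle X T]|.
Proof. by []. Qed.

Lemma is_triangleP X T a : is_triangle X T -> a \in T ->
  exists b c, [/\ T = [set a; b; c], adj X a b, adj X a c & adj X b c].
Proof.
move=> /andP[T3 /forall_inP H] aT.
have adjT x y : x \in T -> y \in T -> x != y -> adj X x y.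
  by move=> xT yT xy; have /forall_inP/(_ y yT)/implyP/(_ xy) := H x xT.
have : #|T :\ a| == 2 by move: T3; rewrite (cardsD1 a T) aT.
case/cards2P=> b [c [bc E]].
have /setD1P[ba bT] : b \in T :\ a by rewrite E set21.
have /setD1P[ca cT] : c \in T :\ a by rewrite E set22.
exists b, c; split; try by apply: adjT => //; rewrite eq_sym.
by rewrite -setUA -E setD1K.
Qed.

Lemma triangleI X a b c : simple X -> adj X a b -> adj X a c -> adj X b c ->
  is_triangle X [set a; b; c].
Proof.
move=> sX ab ac bc; apply/andP; split.
  have U : uniq [:: a; b; c] by distinct.
  have KE : [set a; b; c] =i [:: a; b; c] by move=> x; rewrite !inE -!orbA.
  by rewrite (eq_card KE) (card_uniqP U).
have ba : adj X b a by ad.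
have ca : adj X c a by ad.
have cb : adj X c b by ad.
apply/forall_inP => x; rewrite !inE -!orbA => hx; apply/forall_inP => y.
rewrite !inE -!orbA => hy; apply/implyP.
by case/or3P: hx => /eqP->; case/or3P: hy => /eqP->; rewrite ?eqxx.
Qed.

Lemma triangle_adj X T x y : is_triangle X T -> x \in T -> y \in T -> x != y -> adj X x y.
Proof.
by move=> /andP[_ /forall_inP H] xT yT xy; have /forall_inP/(_ y yT)/implyP/(_ xy) := H x xT.
Qed.

Definition triangles_in X K := [set T | is_triangle X T && (T \subset K)].
Definition neighbours X K := [set y | [exists x in K, adj X x y]].
(** The vertices within distance two of [T]; for a triangle in a P6-free graph this is its
    component. *)
Definition ball X T := T :|: neighbours X T :|: neighbours X (neighbours X T).

Lemma neighboursP X K y :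
  reflect (exists2 x, x \in K & adj X x y) (y \in neighbours X K).
Proof. by rewrite inE; apply: (iffP exists_inP). Qed.

(** * Triangles in one component meet pairwise *)

Section P6free.
Variables (X : graph n).
Hypotheses (F : P6_free X) (sX : simple X).

(* A vertex at distance three from a triangle would give a path on six vertices. *)
Lemma ball_closed T : is_triangle X T -> adj_closed X (ball X T).
Proof.
move=> tT x y xS xy; apply: contraT => yS.
have [yT yN yNN] : [/\ y \notin T, y \notin neighbours X T &
    y \notin neighbours X (neighbours X T)].
  by move: yS; rewrite /ball !in_setU !negb_or => /andP[/andP[]].
have xT : x \notin T by apply: contra yN => xT; apply/neighboursP; exists x.
have xN : x \notin neighbours X T by apply: contra yNN => xT'; apply/neighboursP; exists x.
have /neighboursP[z zN zx] : x \in neighbours X (neighbours X T).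
  by move: xS; rewrite /ball !in_setU (negPf xT) (negPf xN).
have zT : z \notin T by apply: contra xN => zT; apply/neighboursP; exists z.
have zy : z != y by apply: contraNneq yN => <-.
have /neighboursP[t tT' tz] := zN.
have [b [c [ET tb tc bc]]] := is_triangleP tT tT'.
move: xT yT zT; rewrite ET !inE !negb_or -!andbA.
move=> /and3P[? ? ?] /and3P[? ? ?] /and3P[? ? ?].
p6 F b c t z x y.
Qed.

(** Two disjoint triangles that both meet [T0] are joined by an edge of [T0]; running through all of
    both gives a path on six vertices. *)
Lemma triangles_meet_trans T0 T1 T2 : is_triangle X T0 -> is_triangle X T1 ->
  is_triangle X T2 -> T1 :&: T0 != set0 -> T2 :&: T0 != set0 -> T1 :&: T2 != set0.
Proof.
move=> t0 t1 t2 /set0Pn[a1 /setIP[a1T a10]] /set0Pn[a2 /setIP[a2T a20]].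
apply: contraT; rewrite negbK => /eqP E.
have dis x y : x \in T1 -> y \in T2 -> x != y.
  move=> h1 h2; apply: contraTneq h2 => <-; apply: contraT; rewrite negbK => h2.
  by have : x \in T1 :&: T2; [rewrite inE h1 | rewrite E inE].
have [b1 [c1 [E1 ab1 ac1 bc1]]] := is_triangleP t1 a1T.
have [b2 [c2 [E2 ab2 ac2 bc2]]] := is_triangleP t2 a2T.
have b1T : b1 \in T1 by rewrite E1 !inE eqxx orbT.
have c1T : c1 \in T1 by rewrite E1 !inE eqxx orbT.
have b2T : b2 \in T2 by rewrite E2 !inE eqxx orbT.
have c2T : c2 \in T2 by rewrite E2 !inE eqxx orbT.
have a12 := triangle_adj t0 a10 a20 (dis _ _ a1T a2T).
have := dis _ _ a1T b2T; have := dis _ _ a1T c2T.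
have := dis _ _ b1T b2T; have := dis _ _ b1T c2T; have := dis _ _ b1T a2T.
have := dis _ _ c1T b2T; have := dis _ _ c1T c2T; have := dis _ _ c1T a2T.
move=> *; p6 F c1 b1 a1 a2 b2 c2.
Qed.

(** A disjoint triangle at distance one gives a path through all six vertices of the two; at
    distance two, one vertex of [T0] is replaced by the intermediate vertex [z]. *)
Lemma ball_meet T0 T1 : is_triangle X T0 -> is_triangle X T1 -> T1 \subset ball X T0 ->
  T1 :&: T0 != set0.
Proof.
move=> t0 t1 sub; apply: contraT; rewrite negbK => /eqP E.
have dis x y : x \in T1 -> y \in T0 -> x != y.
  move=> h1 h2; apply: contraTneq h2 => <-; apply: contraT; rewrite negbK => h2.
  by have : x \in T1 :&: T0; [rewrite inE h1 | rewrite E inE].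
have near d : d \in T1 -> d \in neighbours X T0 -> False.
  move=> dT /neighboursP[t tT td].
  have [b [c [ET tb tc bc]]] := is_triangleP t0 tT.
  have [e [f [ED de df ef]]] := is_triangleP t1 dT.
  have eT : e \in T1 by rewrite ED !inE eqxx orbT.
  have fT : f \in T1 by rewrite ED !inE eqxx orbT.
  have bT : b \in T0 by rewrite ET !inE eqxx orbT.
  have cT : c \in T0 by rewrite ET !inE eqxx orbT.
  have := dis _ _ dT bT; have := dis _ _ dT cT; have := dis _ _ dT tT.
  have := dis _ _ eT bT; have := dis _ _ eT cT; have := dis _ _ eT tT.
  have := dis _ _ fT bT; have := dis _ _ fT cT; have := dis _ _ fT tT.
  move=> *; p6 F b c t d e f.
have [d dT] : exists d, d \in T1.
  by apply/set0Pn; rewrite -card_gt0; case/andP: t1 => /eqP->.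
have := subsetP sub d dT; rewrite /ball !in_setU -orbA => /or3P[h|h|].
- by have := dis d d dT h; rewrite eqxx.
- by case: (near d).
case/neighboursP=> z zN zd; have [t tT tz] := neighboursP _ _ _ zN.
have zT1 : z \notin T1 by apply/negP => zT; apply: near zT zN.
have zT0 : z \notin T0.
  by apply/negP => zT; apply: (near d dT); apply/neighboursP; exists z.
have [b [c [ET tb tc bc]]] := is_triangleP t0 tT.
have [e [f [ED de df ef]]] := is_triangleP t1 dT.
have eT : e \in T1 by rewrite ED !inE eqxx orbT.
have fT : f \in T1 by rewrite ED !inE eqxx orbT.
have bT : b \in T0 by rewrite ET !inE eqxx orbT.
have := dis _ _ dT bT; have := dis _ _ dT tT.
have := dis _ _ eT bT; have := dis _ _ eT tT.
have := dis _ _ fT bT; have := dis _ _ fT tT.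
move: zT1 zT0; rewrite {1}ED {1}ET !inE !negb_or -!andbA => /and3P[? ? ?] /and3P[? ? ?].
move=> *; p6 F b t z d e f.
Qed.

Lemma triangles_meet T0 T1 T2 : is_triangle X T0 ->
  T1 \in triangles_in X (ball X T0) -> T2 \in triangles_in X (ball X T0) ->
  T1 :&: T2 != set0.
Proof.
move=> t0; rewrite !inE => /andP[t1 s1] /andP[t2 s2].
by apply: (triangles_meet_trans t0 t1 t2); exact: ball_meet.
Qed.

End P6free.

(** * At most half as many triangles as vertices *)

Section Good.
Variables (C B : graph n).
Hypothesis G : good C B.

Let sC : simple C. Proof. by case: G => [[]]. Qed.
Let sB : simple B. Proof. by case: G => [[]]. Qed.
Let dCB : forall f, f \in C -> f \notin B. Proof. by case: G => [[]]. Qed.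
Let F : P6_free C. Proof. by case: G => [[]]. Qed.
Let count : count_cond C B. Proof. by case: G => [[]]. Qed.
Let book : book_cond C B. Proof. by case: G => [_ []]. Qed.
Let K4 : no_K4 C.
Proof. by case: G => [_ [_ _ _ h]]; exact: no_K4_diamond sC h. Qed.

Lemma no_fan w z a b c : z != b -> z != c -> a != c ->
  adj C w z -> adj C w a -> adj C w b -> adj C w c ->
  adj C z a -> adj C a b -> adj C b c -> False.
Proof.
move=> zb zc ac wz wa wb wc za ab bc.
have [K [cK K5 h7]] := fan_closed F sC zb zc ac wz wa wb wc za ab bc.
have h5 : #|K| <= 5 by rewrite K5.
have := count cK h5; rewrite K5 -[5./2]/2 => hc.
have dis : inner C K :&: inner B K = set0.
  by apply/setP => f; rewrite !inE; apply/negP => /andP[/andP[/dCB/negP fB _] /andP[]].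
have : #|inner (C :|: B) K| <= 10.
  by apply: card_inner_simple => // f; rewrite inE => /orP[/sC|/sB].
have -> : inner (C :|: B) K = inner C K :|: inner B K.
  by apply/setP => f; rewrite !inE andb_orl.
have := cardsUI (inner C K) (inner B K); rewrite dis cards0 addn0 => -> h10.
move: (#|inner C K|) (#|inner B K|) h7 hc h10; clear; move=> p q; lia.
Qed.

Section Ball.
Variable T0 : {set 'I_n}.
Hypothesis t0 : is_triangle C T0.
Notation S := (ball C T0).
Notation TS := (triangles_in C S).
Let cS : adj_closed C S := ball_closed F sC t0.

Let in_TS a b c : a \in S -> adj C a b -> adj C a c -> adj C b c -> [set a; b; c] \in TS.
Proof.
move=> aS ab ac bc; rewrite inE triangleI //= !subUset !sub1set aS.
by rewrite (cS aS ab) (cS aS ac).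
Qed.

(** A triangle through just one end [p] of the spine yields a fan if it uses [x] or [y], and
    otherwise the path [r s p x q y]. A triangle avoiding both ends must meet [u v x] in [x] and
    [u v y] in [y], which gives a [K_4]. *)
Lemma book_triangles u v x y T : u \in S -> x != y -> adj C u v ->
  adj C u x -> adj C v x -> adj C u y -> adj C v y -> T \in TS ->
  (u \in T) && (v \in T).
Proof.
move=> uS xy uv ux vx uy vy TT; apply: contraT => nuv.
have tT : is_triangle C T by move: TT; rewrite inE => /andP[].
have [mx my] := (triangles_meet F sC t0 TT (in_TS uS uv ux vx),
                 triangles_meet F sC t0 TT (in_TS uS uv uy vy)).
have nxy : ~~ adj C x y by apply/negP; apply: K4 uv ux vx uy vy.
have one p q : adj C p q -> adj C p x -> adj C q x -> adj C p y -> adj C q y ->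
    p \in T -> q \notin T -> False.
  move=> pq px qx py qy pT qT.
  have [r [s [ET pr ps rs]]] := is_triangleP tT pT.
  have [rq sq] : r != q /\ s != q.
    by split; apply: contraNneq qT => <-; rewrite ET !inE eqxx ?orbT.
  have end1 r' s' x' y' : x' != y' -> ~~ adj C x' y' -> adj C p x' -> adj C q x' ->
      adj C p y' -> adj C q y' -> adj C p s' -> adj C r' s' -> s' != q -> r' = x' -> False.
    move=> xy' nxy' px' qx' py' qy' ps' rs' sq' ?; subst r'.
    have sy' : s' != y' by apply: contraNneq nxy' => <-.
    by apply: (@no_fan p s' x' q y'); (ad || ne || idtac).
  have yx : y != x by ne.
  have nyx : ~~ adj C y x by rewrite adjC.
  have sr : adj C s r by ad.
  have [h|rx] := eqVneq r x; first exact: (end1 r s x y).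
  have [h|ry] := eqVneq r y; first exact: (end1 r s y x).
  have [h|sx] := eqVneq s x; first exact: (end1 s r x y).
  have [h|sy] := eqVneq s y; first exact: (end1 s r y x).
  p6 F r s p x q y.
have [uT|uT] := boolP (u \in T).
  by case: (one u v) => //; move: nuv; rewrite uT.
have [vT|vT] := boolP (v \in T); first by case: (one v u) => //; ad.
have mem z : T :&: [set u; v; z] != set0 -> z \in T.
  case/set0Pn=> w; rewrite !inE => /andP[wT] /orP[/orP[]|] /eqP h; subst w => //.
    by rewrite wT in uT.
  by rewrite wT in vT.
by case/negP: nxy; apply: triangle_adj tT _ _ xy; apply: mem.
Qed.

(** Every triangle corresponds to a page. With two pages, [2 t <= 4] and four vertices are present;
    with more, pages, blocked vertices and the two ends of the spine are disjoint in [S], and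
    [t <= b + 2]. *)
Lemma card_book_triangles u v x y : u \in S -> x != y -> adj C u v ->
  adj C u x -> adj C v x -> adj C u y -> adj C v y -> #|TS|.*2 <= #|S|.
Proof.
move=> uS xy uv ux vx uy vy.
have le : #|TS| <= #|pages C u v|.
  apply: leq_trans (leq_imset_card (fun z => [set u; v; z]) _).
  apply/subset_leq_card/subsetP => T TT.
  have /andP[uT vT] := book_triangles uS xy uv ux vx uy vy TT.
  have tT : is_triangle C T by move: TT; rewrite inE => /andP[].
  have [b [c [ET ub uc bc]]] := is_triangleP tT uT.
  have nuv := adj_neq sC uv.
  move: vT; rewrite ET !inE eq_sym (negPf nuv) /= => /orP[]/eqP h; subst v.
    by apply/imsetP; exists c => //; rewrite inE uc.
  apply/imsetP; exists b; first by rewrite inE ub adjC.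
  by apply/setP => z; rewrite !inE orbAC.
have vS := cS uS uv; have nuv := adj_neq sC uv.
have sub (W : {set 'I_n}) : W \subset S -> u \notin W -> v \notin W -> #|W|.+2 <= #|S|.
  move=> WS uW vW; apply: (@leq_trans #|u |: (v |: W)|).
    by rewrite !cardsU1 !inE negb_or nuv uW vW.
  by apply: subset_leq_card; rewrite !subUset !sub1set uS vS.
have upg : u \notin pages C u v.
  by rewrite inE negb_and; apply/orP; left; apply/negP => /(adj_neq sC); rewrite eqxx.
have vpg : v \notin pages C u v.
  by rewrite inE negb_and; apply/orP; right; apply/negP => /(adj_neq sC); rewrite eqxx.
have pS : pages C u v \subset S.
  by apply/subsetP => z; rewrite inE => /andP[uz _]; exact: cS uz.
have [P|P] := leqP #|pages C u v| 2.
  apply: leq_trans (_ : 4 <= _); first by rewrite -[4]/(2.*2) leq_double (leq_trans le).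
  have := sub [set x; y]; rewrite cards2 xy; apply.
  - by rewrite subUset !sub1set (cS uS ux) (cS uS uy).
  - by rewrite !inE negb_or (adj_neq sC ux) (adj_neq sC uy).
  - by rewrite !inE negb_or (adj_neq sC vx) (adj_neq sC vy).
have cov := covering_pages F sC K4 uv P.
have hb : #|pages C u v| <= #|blocked C B u v|.+2.
  by case: (book uv cov) => [/leqW|[]].
have dis : pages C u v :&: blocked C B u v = set0.
  apply/setP => z; rewrite !inE; apply/negP => /andP[/andP[uz vz]].
  by case/orP=> /andP[_]; apply/negP; exact: dCB.
have := sub (pages C u v :|: blocked C B u v).
rewrite cardsU dis cards0 subn0 => h.
rewrite -addnn; apply: leq_trans (leq_add le le) _.
apply: leq_trans (leq_add (leqnn _) hb) _; rewrite !addnS; apply: h.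
- rewrite subUset pS; apply/subsetP => z; rewrite inE => /orP[]/andP[h _]; exact: cS h.
- rewrite inE negb_or upg inE negb_or !negb_and /=; apply/andP; split; apply/orP.
    by left; apply/negP => /(adj_neq sC); rewrite eqxx.
  by right; apply/negP => /(adj_neq sB); rewrite eqxx.
- rewrite inE negb_or vpg inE negb_or !negb_and /=; apply/andP; split; apply/orP.
    by right; apply/negP => /(adj_neq sB); rewrite eqxx.
  by left; apply/negP => /(adj_neq sC); rewrite eqxx.
Qed.

(** Outside the book case distinct triangles share at most one vertex. Since they meet pairwise, two
    or more of them all pass through one vertex [a] and are otherwise disjoint. *)
Lemma card_ball_triangles : #|TS|.*2 <= #|S|.
Proof.
have [[u [v [x [y [[uS xy uv] ux vx uy vy]]]]]|nd] := classic (exists u v x y,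
    [/\ [/\ u \in S, x != y & adj C u v], adj C u x, adj C v x, adj C u y & adj C v y]).
  exact: card_book_triangles ux vx uy vy.
have S3 : 3 <= #|S|.
  have T3 : #|T0| = 3 by case/andP: t0 => /eqP.
  by rewrite -T3; apply: subset_leq_card; rewrite /ball -setUA subsetUl.
have [le1|/card_gt1P[T1 [T2 [T1S T2S T12]]]] := leqP #|TS| 1.
  by apply: leq_trans S3; rewrite (@leq_trans 1.*2) ?leq_double.
have tri T : T \in TS -> is_triangle C T /\ T \subset S by rewrite inE => /andP.
have [[t1 s1] [t2 s2]] := (tri _ T1S, tri _ T2S).
have /set0Pn[a /setIP[a1 a2]] := triangles_meet F sC t0 T1S T2S.
have aS := subsetP s1 _ a1.
have [b [c [E1 ab ac bc]]] := is_triangleP t1 a1.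
have [d [e [E2 ad ae de]]] := is_triangleP t2 a2.
have share x y z : x \in S -> adj C x y -> adj C x z -> adj C y z ->
    forall t, adj C x t -> adj C y t -> t = z.
  move=> xS xy xz yz t xt yt; apply/eqP; apply: contraT => tz.
  by case: nd; exists x, y, t, z.
have common T x y : x != y -> T \in TS -> x \in T -> y \in T ->
    forall T', T' \in TS -> x \in T' -> y \in T' -> T = T'.
  move=> xy /tri[tT sT] xT yT T' /tri[tT' sT'] xT' yT'.
  have half U : is_triangle C U -> x \in U -> y \in U ->
      exists z, [/\ adj C x y, adj C x z, adj C y z & U = [set x; y; z]].
    move=> tU xU yU; have [p [q [EU xp xq pq]]] := is_triangleP tU xU.
    move: yU; rewrite {1}EU !inE eq_sym (negPf xy) /= => /orP[]/eqP h; subst y.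
      by exists q.
    exists p; split=> //; first by rewrite adjC.
    by rewrite EU; apply/setP => z; rewrite !inE orbAC.
  have [z [h1 h2 h3 ->]] := half T tT xT yT.
  have [z' [k1 k2 k3 ->]] := half T' tT' xT' yT'.
  by rewrite (share x y z (subsetP sT _ xT) h1 h2 h3 z' k2 k3).
(* A triangle avoiding [a] would meet [T1] in [x] and [T2] in [y]; then [a x y] is a triangle
   sharing an edge with both, so [T1 = T2]. *)
have all_a T : T \in TS -> a \in T.
  move=> TT; apply: contraT => aT; have [tT sT] := tri _ TT.
  have /set0Pn[x /setIP[xT x1]] := triangles_meet F sC t0 TT T1S.
  have /set0Pn[y /setIP[yT y2]] := triangles_meet F sC t0 TT T2S.
  have xa : x != a by apply: contraNneq aT => <-.
  have ya : y != a by apply: contraNneq aT => <-.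
  have [xy|xy] := eqVneq x y.
    subst y; case/eqP: T12; exact: (common T1 x a).
  have xadjy := triangle_adj tT xT yT xy.
  have [ax ay] : adj C a x /\ adj C a y.
    split; [apply: triangle_adj t1 a1 x1 _ | apply: triangle_adj t2 a2 y2 _]; by rewrite eq_sym.
  have TN : [set a; x; y] \in TS by exact: in_TS.
  have m1 : T1 = [set a; x; y].
    by apply: (common T1 x a) => //; rewrite !inE eqxx ?orbT.
  have m2 : T2 = [set a; x; y].
    by apply: (common T2 y a) => //; rewrite !inE eqxx ?orbT.
  by case/eqP: T12; rewrite m1 m2.
(* Double counting: each triangle has two vertices besides [a], and each such vertex lies in at most
   one triangle. *)
have -> : #|TS|.*2 = \sum_(T in TS) #|T :\ a|.
  rewrite -muln2 -sum_nat_const; apply: eq_bigr => T TT.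
  have [/andP[/eqP T3 _] _] := tri _ TT.
  by move: T3; rewrite (cardsD1 a T) all_a // => -[].
apply: leq_trans (_ : #|S :\ a| <= _); last by apply: subset_leq_card; exact: subsetDl.
rewrite -sum1_card.
rewrite (eq_bigr (fun T => \sum_(x in S :\ a) (x \in T))); last first.
  move=> T TT; have [_ sT] := tri _ TT; rewrite -sum1_card big_mkcond /= [RHS]big_mkcond /=.
  apply: eq_bigr => x _; rewrite !in_setD1; have [xT|xT] := boolP (x \in T); last by rewrite andbF; case: ifP.
  by rewrite (subsetP sT _ xT) andbT.
rewrite exchange_big /=; apply: leq_sum => x /setD1P[xa xS].
rewrite -big_mkcondr /= sum1_card; apply/card_le1_eqP => T T' /andP[TT xT] /andP[TT' xT'].
by apply: esym; apply: (common T x a) => //; apply: all_a.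
Qed.
End Ball.

(** Induction on the size of [K], splitting off the component of one triangle. *)
Lemma card_triangles_in K : adj_closed C K -> #|triangles_in C K|.*2 <= #|K|.
Proof.
have [m] := ubnP #|K|; elim: m K => // m IH K Km cK.
have [->|[T0]] := set_0Vmem (triangles_in C K); first by rewrite cards0.
rewrite inE => /andP[t0 sT0]; pose S := ball C T0; pose D := K :\: S.
have cS : adj_closed C S := ball_closed F sC t0.
have nK (L : {set 'I_n}) : L \subset K -> neighbours C L \subset K.
  by move=> LK; apply/subsetP => y /neighboursP[x /(subsetP LK) xK]; apply: cK.
have SK : S \subset K by rewrite /S /ball !subUset sT0 !nK.
have cD : adj_closed C D.
  move=> x y; rewrite !in_setD => /andP[xS xK] xy; rewrite (cK x y) // andbT.
  by apply: contra xS => yS; apply: (cS y) => //; rewrite adjC.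
have KD : #|K| = #|S| + #|D|.
  by rewrite -(cardsID S K); congr (#|pred_of_set _| + _); apply/setIidPr.
have S0 : 0 < #|S|.
  have T3 : #|T0| = 3 by case/andP: t0 => /eqP.
  by apply: (@leq_trans 3) => //; rewrite -T3 /S /ball -setUA subset_leq_card // subsetUl.
have Dm : #|D| < m by move: Km; rewrite ltnS KD; apply: leq_trans; rewrite -add1n leq_add2r.
have hD := IH D Dm cD; have hS := card_ball_triangles t0.
have : triangles_in C K \subset triangles_in C S :|: triangles_in C D.
  apply/subsetP => T; rewrite 3!inE ![T \in triangles_in _ _]inE => /andP[tT sT]; rewrite tT /=.
  have [/set0Pn[a /setIP[aT aS]]|/negbNE/eqP E] := boolP (T :&: S != set0).
    have [b [c [ET ab ac bc]]] := is_triangleP tT aT.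
    by rewrite ET !subUset !sub1set aS (cS _ _ aS ab) (cS _ _ aS ac).
  by apply/orP; right; rewrite subsetD sT -setI_eq0 E eqxx.
move/subset_leq_card/leq_trans/(_ (leq_card_setU _ _)).
rewrite -leq_double doubleD => /leq_trans; apply.
by rewrite KD leq_add.
Qed.

Theorem good_triangles : (triangles C).*2 <= n.
Proof.
have := @card_triangles_in [set: 'I_n]; rewrite cardsT card_ord => H.
have {}H : #|triangles_in C [set: 'I_n]|.*2 <= n by apply: H => x y; rewrite !inE.
by move: H; rewrite trianglesE /triangles_in; under eq_finset do rewrite subsetT andbT.
Qed.
End Good.
End Triangles.

(** * Game values *)

Lemma bigminn_le (T : finType) (A : {set T}) (F : T -> nat) x j : j \in A ->
  \big[minn/x]_(i in A) F i <= F j.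
Proof.
move=> jA; have := mem_index_enum j; elim: (index_enum T) => // i r IH.
rewrite inE big_cons => /orP[/eqP<-|/IH le]; first by rewrite jA geq_minl.
by case: ifP => // _; rewrite geq_min le orbT.
Qed.

Lemma bigminn_ge (T : finType) (A : {set T}) (F : T -> nat) x m : m <= x ->
  (forall j, j \in A -> m <= F j) -> m <= \big[minn/x]_(i in A) F i.
Proof.
move=> mx H; elim/big_ind: _ => // p q hp hq; by rewrite leq_min hp.
Qed.

Lemma bigmaxn_ge (T : finType) (A : {set T}) (F : T -> nat) x j : j \in A ->
  F j <= \big[maxn/x]_(i in A) F i.
Proof.
move=> jA; have := mem_index_enum j; elim: (index_enum T) => // i r IH.
rewrite inE big_cons => /orP[/eqP<-|/IH le]; first by rewrite jA leq_maxl.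
by case: ifP => // _; rewrite leq_max le orbT.
Qed.

Section Game.
Context {n : nat}.
Implicit Types (C B : graph n) (e f : {set 'I_n}).

Lemma unclaimed_addl C B e : e \in unclaimed C B ->
  #|unclaimed (e |: C) B| < #|unclaimed C B|.
Proof.
move=> eu; rewrite (cardsD1 e (unclaimed C B)) eu ltnS; apply/subset_leq_card/subsetP => f.
by rewrite !inE negb_or => /and3P[-> /andP[-> ->] ->].
Qed.

Lemma unclaimed_addr C B e : e \in unclaimed C B ->
  #|unclaimed C (e |: B)| < #|unclaimed C B|.
Proof.
move=> eu; rewrite (cardsD1 e (unclaimed C B)) eu ltnS; apply/subset_leq_card/subsetP => f.
by rewrite !inE negb_or => /and3P[-> -> /andP[-> ->]].
Qed.

(** On Blocker's turn the invariant may be broken; the second hypothesis is exactly the alternative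
    that [good_reply] provides. *)
Lemma gval_good k :
  (forall C B, good C B -> #|unclaimed C B| <= k -> (gval k true C B).*2 <= n) /\
  (forall C B, (exists2 f, f \in unclaimed C B & good C (f |: B)) \/
      unclaimed C B = set0 /\ good C B ->
    #|unclaimed C B| <= k -> (gval k false C B).*2 <= n).
Proof.
elim: k => [|k [IHt IHf]]; split=> C B.
- by move=> /good_triangles.
- case=> [[f fu _]|[_ /good_triangles]] //.
  by rewrite leqn0 cards_eq0 => /eqP E; rewrite E inE in fu.
- move=> G le /=; case: pickP => [e0 e0C|_]; last exact: (good_triangles G).
  have H e : e \in cmoves C B -> (gval k false (e |: C) B).*2 <= n.
    move=> eC; apply: IHf; first exact: good_reply.
    have eu : e \in unclaimed C B by move: eC; rewrite inE => /andP[].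
    by rewrite -ltnS; apply: leq_trans le; apply: unclaimed_addl.
  elim/big_ind: _; [exact: H | | exact: H].
  by move=> p q hp hq; rewrite /maxn; case: ifP.
- case=> [[f fu G]|[E G]] le /=; case: pickP => [e0 e0C|no].
  + apply: leq_trans (_ : (gval k true C (f |: B)).*2 <= _).
      by rewrite leq_double bigminn_le.
    by apply: IHt => //; rewrite -ltnS; apply: leq_trans le; apply: unclaimed_addr.
  + by rewrite no in fu.
  + by rewrite E inE in e0C.
  + exact: (good_triangles G).
Qed.

Lemma unclaimed0 : unclaimed (set0 : graph n) set0 = [set e | is_edge e].
Proof. by apply/setP => e; rewrite !inE andbT. Qed.

Theorem g_K3_P6_le : (g_K3_P6 n).*2 <= n.
Proof. by apply: (gval_good _).1 good0 _; rewrite unclaimed0. Qed.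

Lemma triangles_add C e : triangles C <= triangles (e |: C).
Proof.
rewrite !trianglesE; apply/subset_leq_card/subsetP => T; rewrite inE => tT; rewrite inE.
apply/andP; split; first by case/andP: tT.
apply/forall_inP => x xT; apply/forall_inP => y yT; apply/implyP => xy.
by rewrite in_setU1; apply/orP; right; apply: triangle_adj tT xT yT xy.
Qed.

(** Claimed edges are never lost, so a count reached during play bounds the final score from
    below. *)
Lemma gval_triangles k t C B : triangles C <= gval k t C B.
Proof.
elim: k t C B => [|k IH] t C B //=; case: t; case: pickP => // e0 e0C.
- apply: leq_trans (bigmaxn_ge _ _ e0C).
  exact: leq_trans (triangles_add _ _) (IH _ _ _).
- by apply: bigminn_ge.
Qed.

(* Blocker is allowed to pass: this costs nothing, and it makes exhausting
   the free edges a non-event. *)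
Inductive force (Q : graph n -> graph n -> Prop) C B : Prop :=
| force_now of Q C B
| force_step e of e \in cmoves C B & forall B',
    B' = B \/ (exists2 f, f \in unclaimed (e |: C) B & B' = f |: B) ->
    force Q (e |: C) B'.

Lemma force_bind (Q Q' : graph n -> graph n -> Prop) C B : force Q C B ->
  (forall C' B', Q C' B' -> force Q' C' B') -> force Q' C B.
Proof.
by move=> H K; elim: H => [{}C {}B /K //|{}C {}B e eC _ IH]; apply: force_step eC IH.
Qed.

Lemma force_gval m C B k : force (fun C' _ => m <= triangles C') C B ->
  #|unclaimed C B| <= k -> m <= gval k true C B.
Proof.
move=> H; elim: H k => [{}C {}B h k _|{}C {}B e eC _ IH k]; first exact: leq_trans (gval_triangles _ _ _ _).
have eu : e \in unclaimed C B by move: eC; rewrite inE => /andP[].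
case: k => [|k] le; first by move: (leq_trans (unclaimed_addl eu) le).
have {}le : #|unclaimed (e |: C) B| <= k.
  by rewrite -ltnS; apply: leq_trans le; apply: unclaimed_addl.
rewrite /=; case: pickP => [e0 _|/(_ e)]; last by rewrite eC.
apply: leq_trans (bigmaxn_ge _ _ eC).
(* When no edge is left, the passing branch [B' = B] of [force] applies with no fuel. *)
have stop : unclaimed (e |: C) B = set0 -> m <= triangles (e |: C).
  by move=> E; apply: (IH B (or_introl erefl) 0); rewrite E cards0.
case: k le => [|k] le /=; first by apply: stop; apply/eqP; rewrite -cards_eq0 -leqn0.
case: pickP => [f0 f0u|no]; last by apply: stop; apply/setP => f; rewrite no inE.
have H f : f \in unclaimed (e |: C) B -> m <= gval k true (e |: C) (f |: B).
  move=> fu; apply: IH; first by right; exists f.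
  by rewrite -ltnS; apply: leq_trans le; apply: unclaimed_addr.
by apply: bigminn_ge; [exact: H | exact: H].
Qed.
End Game.

(** * Constructor's strategy *)

Section Arithmetic.
Variables (M n U r : nat).
Hypotheses (M0 : 0 < M) (nM : 100 * (M * M * M) <= n) (cU : U + r = n).

Lemma round_end : r * M < n -> M.-1 * n <= M * U.
Proof. by rewrite -cU; case: M M0 => // m _; nia. Qed.

Lemma round_degree b : n <= r * M -> 0 < r -> b <= 2 * U -> 2 * b < r * (4 * M).+1.
Proof. by move=> *; nia. Qed.

Lemma round_leaves l : n <= r * M -> r.-1 <= 2 * l + 4 * M -> n <= 4 * M * l.
Proof.
move=> h1 h2; have h3 : r <= 2 * l + 4 * M + 1 by lia.
have h4 : n <= (2 * l + 4 * M + 1) * M := leq_trans h1 (leq_mul h3 (leqnn _)).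
have h5 : M * M <= M * M * M by rewrite leq_pmulr.
have h6 : M <= M * M by rewrite leq_pmulr.
nia.
Qed.

(** Among the [l] leaves the average Blocker degree is at most [(4 U + 2 l) / l], and
    [4 U + 2 l < 4 n <= 16 M l]. *)
Lemma round_second l b : n <= 4 * M * l -> 0 < n -> l + U < n -> b <= 2 * U ->
  2 * (b + l) < l * (16 * M).+1.
Proof. move=> *; nia. Qed.

Lemma round_large l : n <= 4 * M * l -> 25 * (M * M) <= l.
Proof. move=> h; rewrite -(leq_pmul2l (m := 4 * M)) ?muln_gt0 ?M0 //; apply: leq_trans h; nia. Qed.

Lemma round_less U' r' l : U' + r' = n -> U' = U + l.+1 -> r' < r.
Proof. lia. Qed.

Lemma round_blocker b b' l p : b <= 2 * U -> b' <= b + l + p -> p < l ->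
  b' <= 2 * (U + l.+1).
Proof. lia. Qed.

Lemma round_gain l p : 25 * (M * M) <= l -> l.-1 <= 2 * p + 16 * M ->
  M.-1 * l.+1 <= 2 * M * p.
Proof.
case: M M0 => // m _ /= h1 h2; have h3 : l <= 2 * p + 16 * m.+1 + 1 by lia.
nia.
Qed.
End Arithmetic.

(** * Stars grown against Blocker *)

Section Lower.
Context {n : nat}.
Implicit Types (C B : graph n) (e f : {set 'I_n}) (u v x y : 'I_n) (U A L P R : {set 'I_n}).

Definition rays u L : graph n := [set [set u; x] | x in L].
Definition degree B A u := #|[set x in A | adj B u x]|.

Lemma adj_rays u L x y : adj (rays u L) x y -> x = u /\ y \in L \/ y = u /\ x \in L.
Proof.
case/imsetP=> z zL /eqP; rewrite eq_set2.
by case/orP=> /andP[/eqP-> /eqP->]; [left|right].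
Qed.

Lemma rays_adj u L x : x \in L -> adj (rays u L) u x.
Proof. by move=> xL; apply/imsetP; exists x. Qed.

Lemma adjUE X Y x y : adj (X :|: Y : graph n) x y = adj X x y || adj Y x y.
Proof. by rewrite /adj inE. Qed.

Lemma raysU1 u L x : rays u (x |: L) = [set u; x] |: rays u L.
Proof. by rewrite /rays imsetU1. Qed.

Lemma simpleU X Y : simple X -> simple Y -> simple (X :|: Y : graph n).
Proof. by move=> sX sY e; rewrite inE => /orP[/sX|/sY]. Qed.

Lemma simple_rays u L : u \notin L -> simple (rays u L).
Proof.
move=> uL e /imsetP[x xL ->]; rewrite is_edge2.
by apply: contraNneq uL => ->.
Qed.

Lemma degree_add B f A u : degree (f |: B) A u <= (degree B A u).+1.
Proof.
have [x /andP[xA /eqP xf]|no] := pickP (fun x => (x \in A) && ([set u; x] == f)).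
  apply: (@leq_trans #|x |: [set z in A | adj B u z]|).
    apply/subset_leq_card/subsetP => z; rewrite !inE /adj in_setU1 -xf.
    case/andP=> -> /orP[/eqP/set2_injr->|->]; by rewrite ?eqxx ?orbT.
  by rewrite cardsU1; case: (_ \notin _); rewrite ?add1n.
apply/leqW/subset_leq_card/subsetP => z; rewrite !inE /adj in_setU1.
by case/andP=> zA; have := no z; rewrite zA /= => ->.
Qed.

(** Averaging: the degrees over [R] add up to at most twice the number of Blocker's edges. *)
Lemma exists_low_degree B R k : simple B -> 2 * #|B| < #|R| * k.+1 ->
  exists2 u, u \in R & degree B R u <= k.
Proof.
move=> sB lt; apply: NNPP => no.
have H u : u \in R -> k < degree B R u.
  by move=> uR; rewrite ltnNge; apply/negP => h; apply: no; exists u.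
suff : #|R| * k.+1 <= 2 * #|B| by rewrite leqNgt lt.
apply: (@leq_trans (\sum_(u in R) #|[set e in B | u \in e]|)).
  rewrite -sum_nat_const; apply: leq_sum => u /H /leq_trans; apply.
  rewrite /degree -(card_in_imset (f := fun x => [set u; x])); last by move=> x y _ _; apply: set2_injr.
  apply/subset_leq_card/subsetP => e /imsetP[x]; rewrite inE => /andP[_ ux] ->.
  by rewrite inE set21 andbT.
apply: (@leq_trans (\sum_(u in [set: 'I_n]) #|[set e in B | u \in e]|)).
  rewrite [X in X <= _]big_mkcond [X in _ <= X]big_mkcond /=.
  by apply: leq_sum => u _; rewrite inE; case: ifP.
have -> : \sum_(u in [set: 'I_n]) #|[set e in B | u \in e]| = \sum_(e in B) #|e|.
  under eq_bigr => u _ do rewrite -sum1dep_card big_mkcondr /=.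
  rewrite exchange_big /=; apply: eq_bigr => e _.
  by rewrite -sum1_card [RHS]big_mkcond /= big_mkcond /=; apply: eq_bigr => u _; rewrite inE.
rewrite (eq_bigr (fun=> 2)); first by rewrite sum_nat_const mulnC.
by move=> e /sB /eqP.
Qed.

(** Each move adds a ray and each reply takes away at most one. When none is free, at most
    [k + #|L|] vertices of [A] lie outside [L]. *)
Lemma ray_phase C B u A k : u \notin A -> simple B ->
  (forall x, x \in A -> ~~ adj C u x) ->
  (forall L, L \subset A -> P6_free (C :|: rays u L)) ->
  degree B A u <= k ->
  force (fun C' B' => exists L, [/\ L \subset A, C' = C :|: rays u L, simple B',
    #|B'| <= #|B| + #|L| & #|A| <= 2 * #|L| + k]) C B.
Proof.
move=> uA sB CA F dB.
(* Induction on the number [m] of rays still free. *)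
suff H m L B' : #|[set x in A | (x \notin L) && ~~ adj B' u x]| <= m -> L \subset A ->
    simple B' -> #|B'| <= #|B| + #|L| -> degree B' A u <= k + #|L| ->
  force (fun C' B' => exists L, [/\ L \subset A, C' = C :|: rays u L, simple B',
    #|B'| <= #|B| + #|L| & #|A| <= 2 * #|L| + k]) (C :|: rays u L) B'.
  have := H _ set0 B (leqnn _); rewrite sub0set cards0 !addn0 /rays imset0 setU0.
  by apply.
elim: m L B' => [|m IH] L B' hm LA sB' cB' dB'.
  apply: force_now; exists L; split=> //.
  have : A \subset L :|: [set x in A | adj B' u x].
    apply/subsetP => x xA; move: hm; rewrite leqn0 cards_eq0 => /eqP/setP/(_ x).
    by rewrite !inE xA /= => /negbT; rewrite negb_and !negbK.
  move/subset_leq_card/leq_trans/(_ (leq_card_setU _ _)).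
  by rewrite -/(degree B' A u); move: dB'; lia.
have [E|[x]] := set_0Vmem [set x in A | (x \notin L) && ~~ adj B' u x].
  by apply: IH => //; rewrite E cards0.
move=> xav; have := xav; rewrite inE => /and3P[xA xL xB].
have ux : u != x by apply: contraNneq uA => ->.
have E : [set u; x] |: (C :|: rays u L) = C :|: rays u (x |: L).
  by rewrite raysU1 setUCA.
apply: (force_step (e := [set u; x])).
  rewrite !inE is_edge2 ux xB andbT negb_or -/(adj C u x) CA //= -/(adj (rays u L) u x) E.
  rewrite F ?andbT; last by rewrite subUset sub1set xA.
  by apply/negP => /adj_rays[[_]|[h]]; [apply/negP | rewrite h eqxx in ux].
rewrite E => B'' hB''.
have [sB'' [cB'' [dB'' sub]]] : simple B'' /\ #|B''| <= #|B'|.+1 /\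
    degree B'' A u <= (degree B' A u).+1 /\ B' \subset B''.
  case: hB'' => [->|[f fu ->]]; first by do !split.
  split; first by move=> g; rewrite in_setU1 => /orP[/eqP->|/sB' //]; move: fu; rewrite inE => /andP[].
  split; first by rewrite cardsU1; case: (_ \notin _).
  by split; [exact: degree_add | exact: subsetUr].
have cL : #|x |: L| = #|L|.+1 by rewrite cardsU1 xL.
apply: IH => //.
- rewrite -ltnS; apply: leq_trans hm; rewrite [X in _ <= X](cardsD1 x) xav ltnS.
  apply/subset_leq_card/subsetP => z; rewrite !inE negb_or => /and3P[-> /andP[-> ->] h] /=.
  by apply: contra h; apply: adj_sub.
- by rewrite subUset sub1set xA.
- by rewrite cL addnS; apply: leq_trans cB'' _.
- by rewrite cL addnS; apply: leq_trans dB'' _.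
Qed.

(** Earlier rounds stay inside [U], so edges drawn outside [U] form components of their own. *)
Definition settled C U := [/\ simple C, P6_free C & forall x y, adj C x y -> x \in U].

(* Two hubs cannot cover the three disjoint edges of a path on six vertices. *)
Lemma P6_free_hubs C0 C U u v : settled C0 U ->
  (forall x y, adj C x y -> ~~ adj C0 x y ->
     x \notin U /\ [|| x == u, x == v, y == u | y == v]) -> P6_free C.
Proof.
move=> [s0 F0 U0] H; apply: P6_freeI => a b c d f g Un ab bc cd df fg.
have inU x y : adj C x y -> x \in U -> adj C0 x y.
  by move=> xy xU; apply: contraT => /(H _ _ xy)[/negP].
have U0' x y : adj C0 x y -> y \in U by rewrite adjC; apply: U0.
have [aU|aU] := boolP (a \in U).
  have ab0 := inU _ _ ab aU; have bc0 := inU _ _ bc (U0' _ _ ab0).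
  have cd0 := inU _ _ cd (U0' _ _ bc0); have df0 := inU _ _ df (U0' _ _ cd0).
  have fg0 := inU _ _ fg (U0' _ _ df0); exact: (no_P6 F0 Un).
have out x y : adj C x y -> x \notin U -> y \notin U /\ [|| x == u, x == v, y == u | y == v].
  move=> xy xU; have xy0 : ~~ adj C0 x y by apply: contra xU; apply: U0.
  have [_ h] := H _ _ xy xy0; split=> //.
  by rewrite adjC in xy; rewrite adjC in xy0; have [] := H _ _ xy xy0.
have [bU h1] := out _ _ ab aU; have [cU _] := out _ _ bc bU.
have [dU h2] := out _ _ cd cU; have [fU _] := out _ _ df dU.
have [_ h3] := out _ _ fg fU.
move: Un; case/or4P: h1 => /eqP ?; case/or4P: h2 => /eqP ?; case/or4P: h3 => /eqP ?; subst.
all: by rewrite /= !inE !eqxx ?orbT /= ?andbF.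
Qed.

(** * One round: a star and a second star among its leaves *)

Section Round.
Variables (C0 : graph n) (U : {set 'I_n}) (u : 'I_n).
Hypotheses (S0 : settled C0 U) (uU : u \notin U).

Let outU x y : x \notin U -> adj C0 x y -> False.
Proof. by case: S0 => _ _ H xU /H; apply/negP. Qed.

Let rays_out w L x y : w \notin U -> L \subset ~: U -> adj (rays w L) x y ->
  x \notin U /\ ((x == w) || (y == w)).
Proof.
move=> wU /subsetP LU /adj_rays[[-> _]|[-> /LU]]; first by rewrite eqxx.
by rewrite inE eqxx orbT.
Qed.

Lemma P6_free_star L : L \subset ~: U -> P6_free (C0 :|: rays u L).
Proof.
move=> LU; apply: (P6_free_hubs (u := u) (v := u) S0) => x y.
rewrite adjUE => /orP[->//|/(rays_out uU LU)[h1 h2]] _; split=> //.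
by case/orP: h2 => ->; rewrite ?orbT.
Qed.

Lemma P6_free_book L v P : L \subset ~: U -> v \notin U -> P \subset ~: U ->
  P6_free (C0 :|: rays u L :|: rays v P).
Proof.
move=> LU vU PU; apply: (P6_free_hubs (u := u) (v := v) S0) => x y.
rewrite !adjUE -orbA => /or3P[->//|/(rays_out uU LU)[h1 h2]|/(rays_out vU PU)[h1 h2]] _;
  by split=> //; case/orP: h2 => ->; rewrite ?orbT.
Qed.

(** Each [x] in [P] closes the triangle [u v x], which is not among the old ones because no old edge
    meets [u]. *)
Lemma triangles_book L v P : v \in L -> L \subset ~: U -> u \notin L -> P \subset L ->
  v \notin P -> triangles C0 + #|P| <= triangles (C0 :|: rays u L :|: rays v P).
Proof.
move=> vL LU uL PL vP; set C := _ :|: rays v P.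
have [s0 _ U0] := S0.
have uP : u \notin P by apply: contra uL; apply: (subsetP PL).
have uv : u != v by apply: contraNneq uL => ->.
have sC : simple C by do !apply: simpleU => //; exact: simple_rays.
rewrite !trianglesE.
have inj : {in P &, injective (fun x => [set u; v; x])}.
  move=> x y xP yP /setP/(_ x); rewrite !inE eqxx orbT.
  have xu : x == u = false by apply: contraNF uP => /eqP<-.
  have xv : x == v = false by apply: contraNF vP => /eqP<-.
  by rewrite xu xv /= => /esym/eqP.
rewrite -(card_in_imset inj) -cardsUI.
set X0 := [set T | is_triangle C0 T]; set X1 := [set [set u; v; x] | x in P].
have -> : X0 :&: X1 = set0.
  apply/setP => T; rewrite [LHS]inE [RHS]inE; apply/negP => /andP[h /imsetP[x _ E]].
  have tT : is_triangle C0 T by rewrite inE in h.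
  have uT : u \in T by rewrite E !inE eqxx.
  have [b [c [_ ub _ _]]] := is_triangleP tT uT.
  exact: outU ub.
rewrite cards0 addn0; apply/subset_leq_card/subsetP => T.
rewrite in_setU => /orP[h|/imsetP[x xP ->]]; rewrite inE.
  have tT : is_triangle C0 T by rewrite inE in h.
  have [a aT] : exists a, a \in T.
    by apply/set0Pn; rewrite -card_gt0; case/andP: tT => /eqP->.
  have [b [c [-> ab ac bc]]] := is_triangleP tT aT.
  by apply: triangleI => //; rewrite !adjUE ?ab ?ac ?bc.
apply: triangleI => //; rewrite !adjUE.
- by rewrite (rays_adj u vL) orbT.
- by rewrite (rays_adj u (subsetP PL _ xP)) orbT.
- by rewrite (rays_adj v xP) !orbT.
Qed.

Lemma settled_book L v P : v \in L -> L \subset ~: U -> u \notin L -> P \subset L ->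
  v \notin P -> settled (C0 :|: rays u L :|: rays v P) (u |: (U :|: L)).
Proof.
move=> vL LU uL PL vP; have [s0 _ U0] := S0.
have LU' x : x \in L -> x \notin U by move/(subsetP LU); rewrite inE.
split.
- by do !apply: simpleU => //; exact: simple_rays.
- by apply: P6_free_book => //; [exact: LU' | exact: subset_trans LU].
- move=> x y; rewrite !adjUE !inE => /orP[/orP[/U0->|]|].
  + by rewrite orbT.
  + by move/adj_rays => [[-> _]|[_ ->]]; rewrite ?eqxx ?orbT.
  + move/adj_rays => [[-> _]|[_ /(subsetP PL)->]]; by rewrite ?vL ?orbT.
Qed.

(** After the star at [u] Blocker has at most [#|B| + l] edges. The hypothesis on [l] lets averaging
    find a leaf [v] of Blocker degree at most [k1] among the leaves, and every ray of its star
    closes a triangle. *)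
Lemma book_round B k0 k1 : simple B -> degree B (~: U :\ u) u <= k0 ->
  (forall l, #|~: U|.-1 <= 2 * l + k0 -> l + #|U| < n -> 2 * (#|B| + l) < l * k1.+1) ->
  force (fun C' B' => exists U' l p, [/\ settled C' U', simple B',
     #|U'| = #|U| + l.+1, triangles C0 + p <= triangles C' &
     [/\ #|B'| <= #|B| + l + p, p < l, #|~: U|.-1 <= 2 * l + k0 & l.-1 <= 2 * p + k1]]) C0 B.
Proof.
move=> sB d0 H.
have subA L : L \subset ~: U :\ u -> L \subset ~: U /\ u \notin L.
  rewrite subsetD1 => /andP[h1 h2]; by [].
have uA : u \notin ~: U :\ u by rewrite !inE eqxx.
have cA : #|~: U :\ u| = #|~: U|.-1 by rewrite (cardsD1 u (~: U)) inE uU.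
have := @ray_phase C0 B u (~: U :\ u) k0 uA sB _ _ d0.
move=> /(_ _ _)/force_bind; apply.
  by move=> x _; apply/negP; exact: outU.
  by move=> L /subA[LU _]; exact: P6_free_star.
move=> C1 B1 [L [LA -> sB1 cB1 cL]]; rewrite cA in cL.
have [LU uL] := subA _ LA.
have cLU : #|u |: (U :|: L)| = #|U| + #|L|.+1.
  rewrite cardsU1 inE negb_or uU uL /= add1n addnS -cardsUI (_ : U :&: L = set0) ?cards0 ?addn0 //.
  by apply/eqP; rewrite setI_eq0 disjoint_sym disjoints_subset.
have ltLU : #|L| + #|U| < n.
  by have := max_card (mem (u |: (U :|: L))); rewrite card_ord cLU addnS addnC.
have [v vL d1] : exists2 v, v \in L & degree B1 L v <= k1.
  by apply: exists_low_degree => //; apply: leq_ltn_trans (H _ cL ltLU); rewrite leq_mul2l cB1.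
have vU : v \notin U by have := subsetP LU _ vL; rewrite inE.
have uv : u != v by apply: contraNneq uL => ->.
have d1' : degree B1 (L :\ v) v <= k1.
  apply: leq_trans d1; apply/subset_leq_card/subsetP => x; rewrite !inE.
  by case/andP=> /andP[_ ->] ->.
have vA : v \notin L :\ v by rewrite !inE eqxx.
have := @ray_phase (C0 :|: rays u L) B1 v (L :\ v) k1 vA sB1 _ _ d1'.
move=> /(_ _ _)/force_bind; apply.
  move=> x; rewrite !inE => /andP[xv xL]; rewrite adjUE negb_or; apply/andP; split.
    by apply/negP; exact: outU.
  apply/negP => /adj_rays[[h _]|[h _]]; first by rewrite h eqxx in uv.
  by rewrite -h xL in uL.
  move=> P PL; apply: P6_free_book => //; apply: subset_trans PL _.
  exact: subset_trans (subsetDl _ _) LU.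
move=> C2 B2 [P [PL -> sB2 cB2 cP]].
have [PL' vP] : P \subset L /\ v \notin P by move: PL; rewrite subsetD1 => /andP.
have cLv : #|L| = #|L :\ v|.+1 by rewrite (cardsD1 v L) vL.
have pl := subset_leq_card PL.
apply: force_now; exists (u |: (U :|: L)), #|L|, #|P|; split=> //.
- exact: settled_book.
- exact: triangles_book.
- split=> //; last by rewrite cLv.
    by apply: leq_trans cB2 _; rewrite leq_add2r.
  by rewrite cLv ltnS.
Qed.

End Round.

(** Two invariants are carried along: Blocker has at most two edges per used vertex, which keeps
    vertices of low degree available, and each used vertex has paid for [(M - 1) / (2 M)] triangles
    on average. *)
Lemma force_books M C B U : 0 < M -> 100 * (M * M * M) <= n -> settled C U ->
  simple B -> #|B| <= 2 * #|U| -> M.-1 * #|U| <= 2 * M * triangles C ->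
  force (fun C' _ => M.-1 * (M.-1 * n) <= 2 * M * M * triangles C') C B.
Proof.
move=> M0 nM; have [r] := ubnP #|~: U|; elim: r C B U => // r IH C B U Ur SU sB cB pot.
have cU : #|U| + #|~: U| = n by rewrite cardsC card_ord.
have [small|large] := ltnP (#|~: U| * M) n.
  apply: force_now; have le : M.-1 * n <= M * #|U| by exact: round_end M0 nM cU small.
  apply: leq_trans (leq_mul (leqnn _) le) _; rewrite mulnCA.
  apply: leq_trans (leq_mul (leqnn _) pot) _.
  by rewrite !mulnA (mulnC M 2).
have n0 : 0 < n by apply: leq_trans nM; rewrite !muln_gt0 M0.
have U0 : 0 < #|~: U| by move: (leq_trans n0 large); rewrite muln_gt0 => /andP[].
have [u uU du] : exists2 u, u \in ~: U & degree B (~: U) u <= 4 * M.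
  exact: exists_low_degree sB (round_degree M0 nM cU large U0 cB).
have du' : degree B (~: U :\ u) u <= 4 * M.
  apply: leq_trans du; apply/subset_leq_card/subsetP => x; rewrite !inE.
  by case/andP=> /andP[_ ->] ->.
rewrite inE in uU.
have second l : #|~: U|.-1 <= 2 * l + 4 * M -> l + #|U| < n ->
    2 * (#|B| + l) < l * (16 * M).+1.
  move=> hl lU; exact (round_second M0 nM cU (round_leaves M0 nM cU large hl) n0 lU cB).
apply: (force_bind (book_round SU uU sB du' second)).
move=> C' B' [U' [l [p [SU' sB' cU' tri [cB' pl hl hp]]]]].
have l25 := round_large M0 nM cU (round_leaves M0 nM cU large hl).
apply: (IH C' B' U') => //.
- rewrite -ltnS; apply: leq_trans Ur; rewrite ltnS.
  have cU2 : #|U'| + #|~: U'| = n by rewrite cardsC card_ord.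
  exact (round_less M0 nM cU cU2 cU').
- by rewrite cU'; exact (round_blocker M0 nM cU cB cB' pl).
- rewrite cU' mulnDr; apply: leq_trans (leq_mul (leqnn _) tri); rewrite mulnDr.
  by apply: leq_add pot _; exact (round_gain M0 nM cU l25 hp).
Qed.

(** The strict inequality and the successor come from rounding the target [a / d] down to a whole
    number of triangles. *)
Lemma g_K3_P6_ge M : 0 < M -> 100 * (M * M * M) <= n ->
  M.-1 * (M.-1 * n) < 2 * M * M * (g_K3_P6 n).+1.
Proof.
move=> M0 nM; set a := M.-1 * _; set d := 2 * M * M.
have d0 : 0 < d by rewrite !muln_gt0 M0.
have S0 : settled (set0 : graph n) set0.
  split; [by move=> e; rewrite inE | | by move=> x y; rewrite /adj inE].
  by case: (@good0 n) => [[]].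
have H : force (fun C' _ => a <= d * triangles C') (set0 : graph n) set0.
  by apply: (force_books (U := set0)) => //; [move=> e; rewrite inE | rewrite cards0 | rewrite cards0 muln0].
have : a %/ d <= g_K3_P6 n.
  rewrite /g_K3_P6 -unclaimed0; apply: force_gval => //; apply: (force_bind H) => C' B' h.
  by apply: force_now; rewrite -(mulKn (triangles C') d0) leq_div2r.
by rewrite -ltnS ltn_divLR // mulnC.
Qed.

End Lower.

(** * Passage to the limit *)

Import Order.TTheory GRing.Theory Num.Theory.
Local Open Scope ring_scope.

(* g(n,K_3,P_6) = (1+o(1)) n/2 as n -> oo. *)
Theorem theorem1p2 :
  forall eps : rat, 0 < eps ->
  exists N : nat, forall n : nat, (N <= n)%N ->
    `| (g_K3_P6 n)%:R - n%:R / 2 | <= eps * n%:R :> rat.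
Proof.
(* Chosen so that [2 / M <= eps], the total relative error being at most [2 / M]. *)
move=> eps eps0; pose M := (Num.bound (2 / eps)).+1.
have hM : 2 <= eps * M%:R.
  rewrite -ler_pdivrMl // mulrC; apply: le_trans (_ : (Num.bound (2 / eps))%:R <= _).
    by apply/ltW/archi_boundP; rewrite divr_ge0 // ltW.
  by rewrite ler_nat.
exists (100 * (M * M * M))%N => n nN.
have up := @g_K3_P6_le n.
have := @g_K3_P6_ge n M isT nN.
set g := g_K3_P6 n in up *; rewrite [M.-1]/= => lo.
have nM : (M <= n)%N.
  apply: leq_trans nN; rewrite !mulnA -[X in (X <= _)%N]mul1n leq_mul // !muln_gt0.
have upR : g%:R * 2 <= n%:R :> rat by rewrite -natrM ler_nat muln2.
have nMR : M%:R <= n%:R :> rat by rewrite ler_nat.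
have M1 : M%:R = M.-1%:R + 1 :> rat by rewrite -natr1.
have loR : M.-1%:R * (M.-1%:R * n%:R) <= 2 * M%:R * M%:R * (g%:R + 1) :> rat.
  by rewrite natr1 -!natrM ler_nat ltnW.
set m : rat := M%:R in hM nMR M1 loR; set N : rat := n%:R in upR nMR loR *.
set x : rat := g%:R in upR loR *.
have m0 : 0 < m by rewrite ltr0n.
have N0 : 0 <= N by rewrite ler0n.
have eN : 0 <= eps * N by rewrite mulr_ge0 // ltW.
have {}M1 : M.-1%:R = m - 1 by rewrite M1 addrK.
rewrite M1 in loR.
(* Expanding the square in [loR] leaves the error terms [m * N] and [m * m], each at most
   [m * N]. *)
have h1 : m * m * (N / 2 - x) <= 2 * (m * N).
  have h2 : m * m <= m * N by rewrite ler_pM2l.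
  lra.
have h3 : 2 * (m * N) <= m * m * (eps * N).
  have : 2 * (m * N) <= (eps * m) * (m * N) by rewrite ler_wpM2r // mulr_ge0 // ltW.
  by rewrite (_ : eps * m * (m * N) = m * m * (eps * N)) //; ring.
have h4 : N / 2 - x <= eps * N.
  by rewrite -(ler_pM2l (mulr_gt0 m0 m0)) (le_trans h1 h3).
rewrite ler_norml; apply/andP; split; lra.
Qed.
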